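(* Let $a,b\in\mathbb{R}$ satisfy $\tfrac12\le a<\tfrac58$ and $0<b<\tfrac12$, and let $c_{W,1},c_{W,2},c_w>0$. Let $\mu=(\mu_k)_{k\in\mathbb{N}^*}$ be an increasing sequence of distinct real numbers with $\mu_1\ge 1$ such that $$c_{W,1}\Gamma^{a}-c_{W,2}\Gamma^{b}\le \mathcal N_\mu(\Gamma)\le c_{W,1}\Gamma^{a}+c_{W,2}\Gamma^{b}\qquad\text{for all }\Gamma\ge\mu_1,$$ $$\mu_{k+1}-\mu_k\ge \exp\left(-c_w\mu_k^{1/2}\right)\qquad\text{for all }k\in\mathbb{N}^*.$$ Let $\mathcal H$ be a real separable Hilbert space with Hilbert basis $(\phi_k)_{k\in\mathbb{N}^*}$, and let $\mathcal A$ be the diagonal operator $\mathcal A\psi=\sum_{k}\mu_k\langle\psi,\phi_k\rangle_{\mathcal H}\phi_k$ with domain $D(\mathcal A)=\{\psi\in\mathcal H:\sum_k|\mu_k\langle\psi,\phi_k\rangle_{\mathcal H}|^2<+\infty\}$. Let $\mathcal B\in\mathcal H$ be such that there exist $C_{\mathcal B}>0$ and $\delta\in(0,1)$ with $$|\langle\mathcal B,\phi_k\rangle_{\mathcal H}|\ge\exp\left(-C_{\mathcal B}\mu_k^{1-\delta}\right)\qquad\text{for all }k\in\mathbb{N}^*.$$ Set $\varepsilon=\tfrac14\min(5-8a,\,1-2b)$ and $\alpha_{\varepsilon,\delta}=\max\left(\tfrac{1-\varepsilon}{\varepsilon},\tfrac{1-\delta}{\delta}\right)$. Then there exists $C=C(a,b,\varepsilon,\delta,\mathcal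 B,\mu,c_{W,1},c_{W,2},c_w)>0$ such that for any $\xi_0\in\mathcal H$ and any $T\in(0,1)$ there exists $v\in L^2(0,T)$ such that the unique mild solution $\xi$ of $$\xi'(t)+\mathcal A\xi(t)+\mathcal B v(t)=0\ \ (t\in(0,T)),\qquad \xi(0)=\xi_0,$$ satisfies $\xi(T)=0$, and $$\|v\|_{L^2(0,T)}\le C\exp\left(\frac{C}{T^{\alpha_{\varepsilon,\delta}}}\right)\|\xi_0\|_{\mathcal H}.$$
   Context: $\mathbb{N}^*=\{1,2,3,\dots\}$. For a non-decreasing sequence $\lambda=(\lambda_k)_{k\in\mathbb{N}^*}$ of positive reals, $\mathcal N_\lambda(\Gamma)=\#\{k\in\mathbb{N}^*:\lambda_k\le\Gamma\}$. A Hilbert basis is a complete orthonormal system. Controls are real-valued scalar functions, $L^2(0,T)=L^2(0,T;\mathbb{R})$. The mild solution is $\xi(t)=e^{-t\mathcal A}\xi_0-\int_0^t e^{-(t-s)\mathcal A}\mathcal B v(s)\,ds$, where $e^{-t\mathcal A}\phi_k=e^{-\mu_kt}\phi_k$. *)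

(* Defs.v *)
From HB Require Import structures.
From mathcomp Require Import all_boot all_order all_algebra sesquilinear.
From mathcomp Require Import all_classical all_reals all_analysis.

Set Implicit Arguments.
Unset Strict Implicit.
Unset Printing Implicit Defensive.

Import Order.TTheory GRing.Theory Num.Theory.
Import numFieldNormedType.Exports.

Local Open Scope classical_set_scope.
Local Open Scope ring_scope.

(* Sequences indexed by {1, 2, ...} are represented by functions on nat, the
   index k standing for k + 1; in particular mu 0 is mu_1. *)

Section counting_function.
Context (R : realType).

(* Extended-real valued: +oo if infinitely many terms are below x. *)
Definition counting_fun (mu : nat -> R) (x : R) : \bar R :=
  counting [set k | mu k <= x].

End counting_function.

Section hilbert_space.
Context (R : realType) (H : completeNormedModType R).

(* The complete normed space H is a Hilbert space when its norm comes from the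
   positive definite symmetric bilinear form ip. *)
Definition norm_of_dot (ip : {dot H for idfun}) :=
  forall x : H, ip x x = `|x| ^+ 2.

Definition separable_space := exists2 D : set H, countable D & dense D.

Variable ip : {dot H for idfun}.

Definition orthonormal_seq (phi : nat -> H) :=
  forall i j, ip (phi i) (phi j) = (i == j)%:R.

Definition hilbert_basis (phi : nat -> H) :=
  orthonormal_seq phi /\
  dense [set x | exists n (c : nat -> R), x = \sum_(k < n) c k *: phi k].

(* The operator with eigenvalue c k on phi k. The limit is meaningful for x in
   diag_dom phi c, hence for all x when c is bounded. The operator A is
   diag_op phi mu with domain diag_dom phi mu. *)
Definition diag_op (phi : nat -> H) (c : nat -> R) (x : H) : H :=
  limn (series (fun k => (c k * ip x (phi k)) *: phi k)).

Definition diag_dom (phi : nat -> H) (c : nat -> R) : set H :=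
  [set x | (\sum_(0 <= k <oo) (`|c k * ip x (phi k)| ^+ 2)%:E < +oo)%E].

(* exp (- t A), for t >= 0 and A = diag_op phi mu with mu bounded below *)
Definition diag_semigroup (phi : nat -> H) (mu : nat -> R) (t : R) : H -> H :=
  diag_op phi (fun k => expR (- mu k * t)).

Lemma diag_op_basis phi c k : orthonormal_seq phi ->
  diag_op phi c (phi k) = c k *: phi k.
Proof.
move=> phi1; apply: cvg_lim => //.
apply: (@cvg_near_cst _ _ _ _ _ _ _).
exists k.+1 => // n /= kn.
rewrite /series /= (bigD1_seq k) /= ?mem_index_iota ?iota_uniq//.
rewrite phi1 eqxx mulr1 big1 ?addr0// => i ik.
by rewrite phi1 eq_sym (negbTE ik) mulr0 scale0r.
Qed.

Lemma diag_semigroup_basis phi mu t k : orthonormal_seq phi ->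
  diag_semigroup phi mu t (phi k) = expR (- mu k * t) *: phi k.
Proof. exact: diag_op_basis. Qed.

End hilbert_space.

Section bochner.
Context d (X : measurableType d) (R : realType) (H : completeNormedModType R).
Variables (m : {measure set X -> \bar R}) (D : set X).

Definition integrable_simple (g : {fimfun X >-> H}) := forall h : H, h != 0 ->
  measurable (D `&` g @^-1` [set h]) /\ (m (D `&` g @^-1` [set h]) < +oo)%E.

Definition simple_integral (g : {fimfun X >-> H}) : H :=
  \sum_(h \in range g) fine (m (D `&` g @^-1` [set h])) *: h.

(* f is Bochner integrable on the measurable set D, with integral y. *)
Definition is_bochner_integral (f : X -> H) (y : H) :=
  exists s : nat -> {fimfun X >-> H},
    [/\ forall n, integrable_simple (s n),
        {ae m, forall x, D x -> s n x @[n --> \oo] --> f x},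
        (\int[m]_(x in D) `|f x - s n x|%:E)%E @[n --> \oo] --> 0%E
      & simple_integral (s n) @[n --> \oo] --> y].

End bochner.

Section control.
Context (R : realType).

(* Only v on the interval (0, T) matters: the restriction extends by point, which
   is 0 in a realType. *)
Definition L2_control (T : R) (v : R -> R) :=
  (v \_ `]0, T[) \in Lfun (@lebesgue_measure R) 2%:E.

Definition L2_norm (T : R) (v : R -> R) : \bar R :=
  'N[@lebesgue_measure R]_2%:E [EFin \o (v \_ `]0, T[)].

(* Mild solutions on [0, T] of xi' + A xi + B v = 0, xi 0 = xi0, for
   A = diag_op ip phi mu; the values of xi outside [0, T] are irrelevant. *)
Definition mild_solution (H : completeNormedModType R)
    (ip : {dot H for idfun}) (phi : nat -> H) (mu : nat -> R) (B : H)
    (T : R) (v : R -> R) (xi0 : H) (xi : R -> H) :=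
  forall t : R, 0 <= t <= T -> exists2 y : H,
    is_bochner_integral (@lebesgue_measure R) `]0, t[
      (fun s => v s *: diag_semigroup ip phi mu (t - s) B) y &
    xi t = diag_semigroup ip phi mu t xi0 - y.

End control.

(* Main.v *)
(* Moment method. By duality a control steers xi0 to 0 as soon as its moments
   against e^(mu_k s) on (0, T) are xi0_k / B_k, so it suffices to find functions
   q_k supported in [0, T] whose moments against e^(mu_j s) are the Kronecker
   delta. Complex analysis is avoided: q_k is obtained from a bump on the second
   half of [0, T] by applying, for every j <> k, the difference operator
   f |-> f - e^(- mu_j tau_j) f(. - tau_j), which kills the exponential moment at
   mu_j. With tau_j proportional to T mu_j^(-3/4) the delays add up to at most T / 4
   and the infinite product converges uniformly, since mu_j tau_j tends to infinity.
   The price is the product over j <> k of 1 / (1 - e^(- |mu_j - mu_k| tau_j)),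
   bounded by exp (C T^(-3) + C mu_k^(3/4) + C mu_k^(1/2 + b)): the last term comes
   from the at most C mu_k^b eigenvalues at distance less than 1 from mu_k, each
   costing the inverse of a gap. As the bump lives after T / 2, q_k carries a factor
   e^(- mu_k T / 2), which absorbs these powers of mu_k and the lower bound on B_k
   at the expense of exp (C / T^alpha). *)

Require Import Defs.
From HB Require Import structures.
From mathcomp Require Import all_boot all_order all_algebra sesquilinear.
From mathcomp Require Import all_classical all_reals all_analysis.
From mathcomp Require Import measurable_realfun ring lra.

Import Order.TTheory GRing.Theory Num.Theory.
Import numFieldNormedType.Exports.

Local Open Scope classical_set_scope.
Local Open Scope ring_scope.

Set Implicit Arguments.
Unset Strict Implicit.
Unset Printing Implicit Defensive.

(** * Exponential moments *)

Section exp_moment.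
Context (R : realType).
Implicit Types (T z tau r e : R) (f g : R -> R).

(** The delays must be summable while mu_j tau_j still tends to infinity. As a < 5/8, the Weyl law
    gives mu_j >= c j^(8/5), so mu_j^(-3/4) is summable like j^(-6/5), whereas mu_j tau_j grows like
    T mu_j^(1/4). The loss of the far factors is measured through e^x - 1 >= x^3 / 6: with x of
    order T mu_j^(1/4), the inverse cube is of order T^(-3) mu_j^(-3/4), the same summable weight
    again, and this is the origin of T^(-3). The value of eps makes the pieces fit: a >= 1/2 forces
    eps <= 1/4, so that 3/4 <= 1 - eps and T^(-3) <= T^(-alpha), and eps <= (1 - 2b) / 4 yields 1/2
    + b <= 1 - eps. The exponents 1/4, 1/2, 5/8 and 3/4 of mu are multiples of 1/8, so the estimates
    are run on m = mu^(1/8) with natural exponents. *)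

Definition exp_moment T z f : R :=
  \int[@lebesgue_measure R]_(s in `[0, T]) (f s * expR (z * s)).

Lemma continuous_integrable_itv f (u v : R) : continuous f ->
  (@lebesgue_measure R).-integrable `[u, v] (EFin \o f).
Proof.
move=> cf; apply: continuous_compact_integrable; first exact: segment_compact.
exact: continuous_subspaceT.
Qed.

Lemma continuous_mul_expR f z : continuous f ->
  continuous (fun s => f s * expR (z * s)).
Proof.
move=> cf s; apply: cvgM; first exact: cf.
apply: (@continuous_comp _ _ _ (fun s => z * s) expR); last exact: continuous_expR.
exact: mulrl_continuous.
Qed.

Lemma exp_momentBZ T z f g (c : R) : continuous f -> continuous g ->
  exp_moment T z (fun s => f s - c * g s) =
  exp_moment T z f - c * exp_moment T z g.
Proof.
move=> cf cg; rewrite /exp_moment.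
under eq_Rintegral do rewrite mulrBl -mulrA.
have cg' : continuous (fun s => g s * expR (z * s)) by exact: continuous_mul_expR.
rewrite RintegralB//=; last 2 first.
- exact/continuous_integrable_itv/continuous_mul_expR.
- apply: continuous_integrable_itv => s.
  by apply: (continuous_comp (cg' s)); exact: mulrl_continuous.
by rewrite RintegralZl//; exact: continuous_integrable_itv.
Qed.

(** The support condition keeps the translate inside [0, T], so that the truncated moment transforms
    as an integral over the whole line would. *)
Lemma exp_moment_shift T z f tau r : 0 <= tau -> r + tau <= T -> 
  continuous f -> (forall s, f s != 0 -> 0 <= s <= r) ->
  exp_moment T z (fun s => f (s - tau)) = expR (z * tau) * exp_moment T z f.
Proof.
move=> tau0 rT cf f0; have [T0|T0] := ltP T 0.
  by rewrite /exp_moment set_itv_ge ?bnd_simp -?ltNge// !Rintegral_set0 mulr0.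
pose F x := x + tau.
have F1 : derive1 F = cst 1.
  by apply/funext => x; rewrite derive1E deriveD// derive_id derive_cst addr0.
pose G s := f (s - tau) * expR (z * s).
have csub : continuous (fun s => f (s - tau)).
  move=> s; apply: (@continuous_comp _ _ _ (fun s => s - tau) f); last exact: cf.
  by apply: cvgB; [exact: cvg_id|exact: cvg_cst].
have cG : continuous G by exact: continuous_mul_expR.
have cF : continuous F.
  by move=> x; apply: cvgD; [exact: cvg_id|exact: cvg_cst].
have Fa : F (- tau) = 0 by rewrite /F addNr.
have Fb : F (T - tau) = T by rewrite /F subrK.
have := @integration_by_substitution_increasing R F G (- tau) (T - tau).
rewrite Fa Fb F1 lerBrDr addNr => /(_ T0) subst.
rewrite /exp_moment /Rintegral subst; last first.
- exact: continuous_subspaceT.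
- split; last 2 first.
  + by apply: cvg_at_right_filter; exact: cF.
  + by apply: cvg_at_left_filter; exact: cF.
  by move=> x _; apply: (@derivableD _ _ _ id (cst tau)).
- exact: is_cvg_cst.
- exact: is_cvg_cst.
- by move=> x _; exact: cvg_cst.
- by move=> x y _ _; rewrite ltrD2r.
(* After the substitution the domain is [- tau, T - tau]; it may be replaced by [0, T] because [f]
   vanishes outside [0, r]. *)
transitivity (\int[@lebesgue_measure R]_(x in `[0, T]) (expR (z * tau) * (f x * expR (z * x)))).
  rewrite -[LHS]/(Rintegral _ _ _) Rintegral_mkcond [RHS]Rintegral_mkcond.
  apply: eq_Rintegral => x _.
  rewrite /patch !mem_setE !in_itv/= mulr1 /G /F addrK mulrDr expRD.
  have [->|/f0/andP[x0 xr]] := eqVneq (f x) 0; first by rewrite !mul0r mulr0 !if_same.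
  rewrite x0 (le_trans _ x0) ?oppr_le0// lerBrDr.
  have xT : x + tau <= T by rewrite (le_trans _ rT)// lerD2r.
  by rewrite xT (le_trans _ xT) ?lerDl//= mulrA mulrC.
rewrite RintegralZl//; apply: continuous_integrable_itv.
exact: continuous_mul_expR.
Qed.

Lemma exp_moment_close T z f g e : 0 <= T -> 0 <= z -> continuous f -> continuous g ->
  (forall s, `|f s - g s| <= e) ->
  `|exp_moment T z f - exp_moment T z g| <= e * (T * expR (z * T)).
Proof.
move=> T0 z0 cf cg fg; have cf' := @continuous_mul_expR f z cf.
have cg' := @continuous_mul_expR g z cg.
have cfg' : continuous (fun s => f s * expR (z * s) - g s * expR (z * s)).
  by move=> s; apply: cvgB; [exact: cf'|exact: cg'].
rewrite /exp_moment -RintegralB//=; try exact: continuous_integrable_itv.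
apply: le_trans (le_normr_Rintegral _ _) _ => //.
  exact: continuous_integrable_itv.
apply: (@le_trans _ _ (\int[@lebesgue_measure R]_(s in `[0, T]) (e * expR (z * T)))).
  apply: le_Rintegral => //.
  - apply: continuous_integrable_itv => s.
    by apply: (continuous_comp (cfg' s)); exact: norm_continuous.
  - by apply: continuous_integrable_itv => s; exact: cvg_cst.
  move=> s /=; rewrite in_itv/= => /andP[s0 sT].
  rewrite -mulrBl normrM ler_pM// ger0_norm ?expR_ge0// ler_expR.
  exact: ler_wpM2l.
rewrite Rintegral_cst//.
rewrite [X in fine X](_ : _ = T%:E); first by rewrite -mulrA [expR _ * _]mulrC.
rewrite -[LHS]/(@lebesgue_measure R `[0, T]%classic).
have [T1|T1|<-] := ltgtP 0 T; last by rewrite set_itv1 lebesgue_measure_set1.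
- by rewrite (@lebesgue_measure_itv R `[0, T]%R)/= lte_fin T1 oppr0 adde0.
- by rewrite leNgt T1 in T0.
Qed.

End exp_moment.

(** * Uniform limits of continuous functions *)

Section uniform_limit.
Context (R : realType).

Lemma norm_cauchy_cvgn (V : completeNormedModType R) (u : nat -> V) :
  (forall e, 0 < e -> exists N, forall n, (N <= n)%N -> `|u n - u N| <= e) ->
  cvgn u.
Proof.
move=> uc; apply/cauchy_cvgP/cauchyP => e e0.
have [N uN] := uc (e / 2) ltac:(by rewrite divr_gt0).
exists (u N); exists N => // n /= Nn; rewrite -ball_normE/= distrC.
by rewrite (le_lt_trans (uN _ Nn))// gtr_pMr// invf_lt1// ltr1n.
Qed.

(** The Weierstrass test for telescoping sums: the tail of the series of [a] is a rate of
    convergence independent of [s]. It serves both for the infinite product of difference operators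
    and for the series of the control. *)
Lemma uniform_limit_bounded_variation (u : nat -> R -> R) (a : nat -> R) (M : R) :
  (forall n, continuous (u n)) ->
  (forall n s, `|u n.+1 s - u n s| <= a n) ->
  (forall n, \sum_(i < n) a i <= M) ->
  exists f, continuous f /\
    forall e, 0 < e -> exists N, forall n, (N <= n)%N ->
      forall s, `|f s - u n s| <= e.
Proof.
move=> cu ua aM.
have a0 n : 0 <= a n by apply: le_trans (ua n 0).
pose S := series a.
have ndS : nondecreasing_seq S by apply: nondecreasing_series => ? _ _; exact: a0.
have cS : cvgn S.
  apply: nondecreasing_is_cvgn => //; exists M => _ [n _ <-].
  by rewrite /S /series/= big_mkord.
have SS m n s : (n <= m)%N -> `|u m s - u n s| <= limn S - S n.
  move=> nm; apply: (@le_trans _ _ (S m - S n)); last first.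
    by rewrite lerB// nondecreasing_cvgn_le.
  rewrite sub_series_geq// -(telescope_sumr (fun i => u i s))//.
  apply: le_trans (ler_norm_sum _ _ _) _.
  exact: ler_sum.
have Slim e : 0 < e -> exists N, forall n, (N <= n)%N -> limn S - S n <= e.
  move=> e0; have /cvgrPdist_le/(_ _ e0)[N _ NS] := cS.
  by exists N => n Nn; rewrite (le_trans (ler_norm _))// NS.
have cus s : cvgn (u ^~ s).
  apply: norm_cauchy_cvgn => e /Slim[N NS]; exists N => n Nn.
  by rewrite (le_trans (SS _ _ _ Nn))// NS.
pose f s := limn (u ^~ s).
have fu n s : `|f s - u n s| <= limn S - S n.
  have cd : `|u m s - u n s| @[m --> \oo] --> `|f s - u n s|.
    apply: cvg_norm; apply: cvgB; [exact: cus|exact: cvg_cst].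
  rewrite -(cvg_lim _ cd)//; apply: limr_le; first by apply/cvg_ex; exists `|f s - u n s|.
  by exists n => // m /=; exact: SS.
exists f; split; last first.
  by move=> e /Slim[N NS]; exists N => n Nn s; rewrite (le_trans (fu _ _))// NS.
move=> x; apply/cvgrPdist_le => e e0.
have e3 : 0 < e / 3 by rewrite divr_gt0.
have [N NS] := Slim _ e3.
have /cvgrPdist_le/(_ _ e3) := cu N x.
apply: filterS => y xy.
have -> : f x - f y = (f x - u N x) + ((u N x - u N y) - (f y - u N y)) by ring.
rewrite (le_trans (ler_normD _ _))//.
have -> : e = e / 3 + (e / 3 + e / 3) by field.
rewrite lerD ?(le_trans (fu _ _)) ?NS//.
by rewrite (le_trans (ler_normB _ _))// lerD// (le_trans (fu _ _)) ?NS.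
Qed.

Section limits.
Context (u : nat -> R -> R) (f : R -> R).
Hypothesis fu : forall e, 0 < e -> exists N, forall n, (N <= n)%N ->
  forall s, `|f s - u n s| <= e.

Lemma uniform_limit_le s h : (forall n, `|u n s| <= h) -> `|f s| <= h.
Proof.
move=> uh; apply/ler_addgt0Pr => e e0; have [N /(_ N (leqnn _) s) fe] := fu e0.
have -> : f s = u N s + (f s - u N s) by ring.
by rewrite (le_trans (ler_normD _ _))// lerD.
Qed.

Lemma uniform_limit_eq0 s : (forall n, u n s = 0) -> f s = 0.
Proof.
by move=> u0; apply/eqP; rewrite -normr_le0 uniform_limit_le// => n; rewrite u0 normr0.
Qed.

Lemma exp_moment_cvg T z : 0 < T -> 0 <= z -> (forall n, continuous (u n)) ->
  continuous f -> exp_moment T z (u n) @[n --> \oo] --> exp_moment T z f.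
Proof.
move=> T0 z0 cu cf; apply/cvgrPdist_le => e e0.
have c0 : 0 < T * expR (z * T) by rewrite mulr_gt0// expR_gt0.
have [N fN] := @fu (e / (T * expR (z * T))) ltac:(by rewrite divr_gt0).
exists N => // n /= Nn.
rewrite (le_trans (exp_moment_close (ltW T0) z0 cf (cu n) (fN _ Nn)))//.
by rewrite divfK// gt_eqF.
Qed.

End limits.

End uniform_limit.

(** * Biorthogonal functions *)

Section annihilation.
Context (R : realType).
Implicit Types (T z : R) (lam tau : nat -> R) (f : R -> R) (k n : nat).

(* Supported in [T / 2, 3 T / 4], so that its moment at z is at least of order
   e^(z T / 2): this is the decay used to sum the controls of the modes. *)
Definition tent T (s : R) : R := Num.max 0 (Num.min (s - T / 2) (3 / 4 * T - s)).

Lemma continuous_tent T : continuous (tent T).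
Proof.
move=> s; apply: (@continuous_max _ _ (cst 0) (fun s => Num.min (s - T / 2) (3 / 4 * T - s))).
  exact: cvg_cst.
apply: (@continuous_min _ _ (fun s => s - T / 2) (fun s => 3 / 4 * T - s)).
  by apply: cvgB; [exact: cvg_id|exact: cvg_cst].
by apply: cvgB; [exact: cvg_cst|exact: cvg_id].
Qed.

Lemma tent_ge0 T s : 0 <= tent T s.
Proof. by rewrite /tent le_max lexx. Qed.

Lemma tentP T s : tent T s = 0 \/
  [/\ 0 <= tent T s, tent T s <= s - T / 2 & tent T s <= 3 / 4 * T - s].
Proof.
rewrite /tent; case: (leP 0 (Num.min _ _)) => h; last by left.
by right; rewrite h !ge_min !lexx orbT.
Qed.

Lemma tent_le T s : 0 < T -> tent T s <= T / 8.
Proof. by move=> T0; case: (tentP T s) => [->|[? ? ?]]; lra. Qed.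

Lemma tent_support T s : tent T s != 0 -> T / 2 <= s <= 3 / 4 * T.
Proof.
by case: (tentP T s) => [->|[? ? ?] _]; rewrite ?eqxx//; apply/andP; split; lra.
Qed.

(** On the middle half of its support, of length T / 8, the tent is at least T / 16; hence the
    factor T^2 / 128. *)
Lemma exp_moment_tent_ge T z : 0 < T -> 0 <= z ->
  T ^+ 2 / 128 * expR (z * (T / 2)) <= exp_moment T z (tent T).
Proof.
move=> T0 z0; rewrite /exp_moment.
have ct : continuous (fun s => tent T s * expR (z * s)).
  by apply: continuous_mul_expR; exact: continuous_tent.
pose J := `[9 / 16 * T, 11 / 16 * T]%classic : set R.
have mJ : measurable J by exact: measurable_itv.
have JT : J `<=` `[0, T]%classic.
  by move=> s; rewrite /J/= !in_itv/= => /andP[? ?]; apply/andP; split; lra.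
apply: (@le_trans _ _ (\int[@lebesgue_measure R]_(s in J) (T / 16 * expR (z * (T / 2))))).
  rewrite Rintegral_cst//.
  rewrite [X in fine X](_ : _ = (T / 8)%:E); last first.
    rewrite -[LHS]/(@lebesgue_measure R J) /J.
    rewrite (@lebesgue_measure_itv R `[9 / 16 * T, 11 / 16 * T]%R)/= lte_fin.
    have -> : 9 / 16 * T < 11 / 16 * T by lra.
    by rewrite -EFinB; congr EFin; field.
  by rewrite /= le_eqVlt; apply/orP; left; apply/eqP; field.
apply: (@le_trans _ _ (\int[@lebesgue_measure R]_(s in J) (tent T s * expR (z * s)))).
  apply: le_Rintegral => //.
  - by apply: continuous_integrable_itv => s; exact: cvg_cst.
  - exact: continuous_integrable_itv.
  move=> s; rewrite /J/= in_itv/= => /andP[s1 s2].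
  rewrite ler_pM ?expR_ge0//.
  - by rewrite divr_ge0// ltW.
  - by rewrite /tent le_max le_min; apply/orP; right; apply/andP; split; lra.
  - by rewrite ler_expR ler_wpM2l//; lra.
rewrite /Rintegral fine_le//.
- by apply: integrable_fin_num => //; exact: continuous_integrable_itv.
- by apply: integrable_fin_num => //; exact: continuous_integrable_itv.
apply: ge0_subset_integral => //.
- apply/measurable_EFinP; apply: measurable_funTS.
  exact: continuous_measurable_fun.
- by move=> s _; rewrite lee_fin mulr_ge0 ?tent_ge0 ?expR_ge0.
Qed.

(* Product over m < n, m <> k of the operators f |-> f - e^(- lam m tau m) f(. - tau m),
   each of which multiplies exp_moment T z f by 1 - e^((z - lam m) tau m), a factor
   vanishing at z = lam m. *)
Fixpoint annihilate lam tau (k : nat) (f : R -> R) (n : nat) : R -> R :=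
  if n is m.+1 then
    if m == k then annihilate lam tau k f m
    else fun s => annihilate lam tau k f m s
      - expR (- (lam m * tau m)) * annihilate lam tau k f m (s - tau m)
  else f.

Lemma continuous_annihilate lam tau k f n : continuous f ->
  continuous (annihilate lam tau k f n).
Proof.
move=> cf; elim: n => //= n IH; case: ifP => // _ s.
apply: cvgB; first exact: IH.
apply: cvgM; first exact: cvg_cst.
apply: (@continuous_comp _ _ _ (fun s => s - tau n)); last exact: IH.
by apply: cvgB; [exact: cvg_id|exact: cvg_cst].
Qed.

(** Each operator multiplies the sup norm by at most 1 + r <= e^r with r = e^(- lam tau); the
    skipped index k only helps. *)
Lemma annihilate_bound lam tau k f n (h : R) : (forall s, `|f s| <= h) ->
  forall s, `|annihilate lam tau k f n s| <=
    h * expR (\sum_(i < n) expR (- (lam i * tau i))).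
Proof.
move=> fh; elim: n => [|n IH] s /=; first by rewrite big_ord0 expR0 mulr1.
rewrite big_ord_recr/= expRD mulrA; set r := expR (- _); set S := expR _ in IH *.
have h0 : 0 <= h * S by exact: le_trans (IH 0).
have hr : h * S <= h * S * expR r.
  by rewrite ler_peMr// -[leLHS]expR0 ler_expR expR_ge0.
case: ifP => _; first exact: le_trans (IH _) hr.
apply: (@le_trans _ _ (h * S * (1 + r))); last first.
  by rewrite ler_wpM2l// expR_ge1Dx.
rewrite (le_trans (ler_normB _ _))// mulrDr mulr1 lerD//.
by rewrite normrM ger0_norm ?expR_ge0// mulrC ler_wpM2r ?expR_ge0.
Qed.

Lemma annihilate_support lam tau k f n (u w : R) : (forall i, 0 <= tau i) ->
  (forall s, f s != 0 -> u <= s <= w) ->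
  forall s, annihilate lam tau k f n s != 0 -> u <= s <= w + \sum_(i < n) tau i.
Proof.
move=> tau0 f0; elim: n => [|n IH] s /=; first by rewrite big_ord0 addr0; exact: f0.
rewrite big_ord_recr/= addrA; have tn := tau0 n; case: ifP => _.
  by move=> /IH/andP[? ?]; apply/andP; split=> //; lra.
have [->|/IH/andP[? ?] _] := eqVneq (annihilate lam tau k f n s) 0.
  rewrite sub0r oppr_eq0 mulf_eq0 negb_or => /andP[_ /IH/andP[? ?]].
  by apply/andP; split; lra.
by apply/andP; split => //; lra.
Qed.

(** The increments are summable in [n] uniformly in [s], which makes the infinite product of
    operators converge uniformly. *)
Lemma annihilate_step lam tau k f n (h : R) : (forall s, `|f s| <= h) ->
  forall s, `|annihilate lam tau k f n.+1 s - annihilate lam tau k f n s| <=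
    expR (- (lam n * tau n)) * (h * expR (\sum_(i < n) expR (- (lam i * tau i)))).
Proof.
move=> fh s /=; have h0 : 0 <= h by exact: le_trans (fh 0).
case: ifP => _; first by rewrite subrr normr0 !mulr_ge0 ?expR_ge0.
rewrite addrAC subrr sub0r normrN normrM ger0_norm ?expR_ge0//.
by rewrite ler_wpM2l ?expR_ge0// annihilate_bound.
Qed.

(** The bound on the total delay keeps every intermediate function supported in [0, T], as the shift
    formula requires. *)
Lemma exp_moment_annihilate T lam tau k f n z (w : R) : (forall i, 0 <= tau i) ->
  continuous f -> (forall s, f s != 0 -> 0 <= s <= w) ->
  w + \sum_(i < n) tau i <= T ->
  exp_moment T z (annihilate lam tau k f n) =
  \prod_(i < n | i != k :> nat) (1 - expR ((z - lam i) * tau i)) * exp_moment T z f.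
Proof.
move=> tau0 cf f0; elim: n => [|n IH] /= wT; first by rewrite big_ord0 mul1r.
rewrite big_mkcond/= big_ord_recr/= -big_mkcond/=.
move: wT; rewrite big_ord_recr/= addrA => wT.
have wT' : w + \sum_(i < n) tau i <= T by have := tau0 n; lra.
case: ifP => nk /=; first by rewrite mulr1; exact: IH.
have cn := @continuous_annihilate lam tau k f n cf.
rewrite exp_momentBZ//; last first.
  move=> s; apply: (@continuous_comp _ _ _ (fun s => s - tau n)); last exact: cn.
  by apply: cvgB; [exact: cvg_id|exact: cvg_cst].
rewrite (@exp_moment_shift _ T z _ (tau n) (w + \sum_(i < n) tau i))//; last first.
  exact: annihilate_support.
have -> : expR ((z - lam n) * tau n) = expR (- (lam n * tau n)) * expR (z * tau n).
  by rewrite -expRD; congr expR; ring.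
by rewrite IH//; ring.
Qed.

(** Makes the factors for lam_i < lam_k and lam_i > lam_k uniform: when y >= 0, expanding (e^y - 1)
    (1 - e^(-y)) >= 0 gives the claim. *)
Lemma one_sub_expR_norm (y : R) : 1 - expR (- `|y|) <= `|1 - expR y|.
Proof.
have [y0|y0] := leP 0 y.
  rewrite ger0_norm// distrC ger0_norm; last first.
    by rewrite subr_ge0 -[leLHS]expR0 ler_expR.
  have ab : expR y * expR (- y) = 1 by rewrite -expRD subrr expR0.
  have a1 : 0 <= expR y - 1 by rewrite subr_ge0 -[leLHS]expR0 ler_expR.
  have b1 : 0 <= 1 - expR (- y) by rewrite subr_ge0 -[leRHS]expR0 ler_expR oppr_le0.
  by have := mulr_ge0 a1 b1; rewrite mulrBl mul1r mulrBr mulr1 ab; lra.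
by rewrite ltr0_norm// opprK ler_norm.
Qed.

(** The uniform limit of the annihilated tents is divided by its own moment at lam_k. The constant
    16 / T is the sup T / 8 of the tent over the factor T^2 / 128 of its moment. *)
Lemma biorthogonal_element T lam tau k (D G : R) : 0 < T -> (forall i, 0 <= lam i) ->
  (forall i, 0 <= tau i) -> (forall n, \sum_(i < n) tau i <= T / 4) ->
  (forall n, \sum_(i < n) expR (- (lam i * tau i)) <= G) ->
  0 < D -> (forall n, D <= \prod_(i < n | i != k :> nat)
                         (1 - expR (- (`|lam i - lam k| * tau i)))) ->
  exists q : R -> R, [/\ continuous q, (forall s, q s != 0 -> 0 <= s <= T),
    (forall s, `|q s| <= 16 / T * (expR G / D) * expR (- (lam k * (T / 2)))) &
    forall j, exp_moment T (lam j) q = (j == k)%:R].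
Proof.
move=> T0 lam0 tau0 tauT expG D0 Dprod.
pose u n := annihilate lam tau k (tent T) n.
have tentT s : `|tent T s| <= T / 8 by rewrite ger0_norm ?tent_ge0// tent_le.
have cu n : continuous (u n) by exact/continuous_annihilate/continuous_tent.
have T8 : 0 <= T / 8 by rewrite divr_ge0// ltW.
have ub n s : `|u n s| <= T / 8 * expR G.
  rewrite (le_trans (annihilate_bound _ _ _ _ tentT s))// ler_wpM2l//.
  by rewrite ler_expR.
have [] := @uniform_limit_bounded_variation R u
  (fun n => expR (- (lam n * tau n)) * (T / 8 * expR G)) (G * (T / 8 * expR G)) cu.
- move=> n s; rewrite (le_trans (annihilate_step _ _ _ _ tentT s))//.
  by rewrite ler_wpM2l ?expR_ge0// ler_wpM2l// ler_expR.
- by move=> n; rewrite -mulr_suml ler_wpM2r// mulr_ge0// expR_ge0.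
move=> f [cf fu].
have tsupp s : tent T s != 0 -> 0 <= s <= 3 / 4 * T.
  by move=> /tent_support/andP[? ?]; apply/andP; split; lra.
have wT n : 3 / 4 * T + \sum_(i < n) tau i <= T by have := tauT n; lra.
have f0 s : f s != 0 -> 0 <= s <= T.
  apply: contra_neqT => sT; apply: (uniform_limit_eq0 fu) => n.
  apply: contraNeq sT => /(@annihilate_support lam tau k _ n _ _ tau0 tsupp)/andP[-> /= h].
  by have := wT n; lra.
have fb s : `|f s| <= T / 8 * expR G by apply: (uniform_limit_le fu) => n; exact: ub.
have fE z (z0 : 0 <= z) := exp_moment_cvg fu T0 z0 cu cf.
have uE z n : exp_moment T z (u n) =
    \prod_(i < n | i != k :> nat) (1 - expR ((z - lam i) * tau i)) * exp_moment T z (tent T).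
  apply: (@exp_moment_annihilate T lam tau k _ n z _ tau0 _ tsupp) => //.
  exact: continuous_tent.
(* As soon as n > j, the product contains the factor of index j, which vanishes at lam_j; the
   sequence of moments is then constantly 0. *)
have Ej j : j != k -> exp_moment T (lam j) f = 0.
  move=> jk; rewrite -(cvg_lim _ (fE _ (lam0 j)))//; apply: lim_near_cst => //.
  exists j.+1 => // n /= jn; rewrite uE.
  by rewrite (bigD1 (Ordinal jn))//= subrr mul0r expR0 subrr !mul0r.
set Ek := exp_moment T (lam k) f.
have Ekge : D * (T ^+ 2 / 128 * expR (lam k * (T / 2))) <= `|Ek|.
  have /cvg_norm := fE _ (lam0 k); rewrite -/Ek => cEk.
  rewrite -(cvg_lim _ cEk)//; apply: limr_ge; first by apply/cvg_ex; exists `|Ek|.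
  exists 0%N => // n _ /=; rewrite uE normrM; apply: ler_pM.
  - exact: ltW.
  - by rewrite mulr_ge0 ?expR_ge0// divr_ge0// sqr_ge0.
  - rewrite (le_trans (Dprod n))// normr_prod; apply: ler_prod => i _.
    rewrite subr_ge0 -[leRHS]expR0 ler_expR oppr_le0 mulr_ge0//=.
    by rewrite (le_trans _ (one_sub_expR_norm _))// normrM (ger0_norm (tau0 _)) distrC.
  - by rewrite (le_trans (exp_moment_tent_ge _ _))// ler_norm.
have T2 : 0 < T ^+ 2 / 128 by rewrite divr_gt0// exprn_gt0.
have Ek0 : 0 < `|Ek| by rewrite (lt_le_trans _ Ekge)// !mulr_gt0// expR_gt0.
exists (fun s => Ek^-1 * f s); split.
- by move=> s; apply: cvgM; [exact: cvg_cst|exact: cf].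
- by move=> s; rewrite mulf_eq0 negb_or => /andP[_]; exact: f0.
- move=> s; rewrite normrM normfV mulrC ler_pdivrMr//.
  apply: (le_trans (fb s)); rewrite expRN.
  apply: (le_trans _ (ler_wpM2l _ Ekge)); last first.
    by rewrite !mulr_ge0 ?invr_ge0 ?expR_ge0 ?(ltW T0) ?(ltW D0).
  rewrite le_eqVlt; apply/orP; left; apply/eqP.
  by field; rewrite !gt_eqF// expR_gt0.
- move=> j.
  have -> : (fun s => Ek^-1 * f s) = (fun s => cst 0 s - (- Ek^-1) * f s).
    by apply/funext => s /=; rewrite sub0r mulNr opprK.
  rewrite exp_momentBZ//; last by move=> s; exact: cvg_cst.
  have -> : exp_moment T (lam j) (cst 0) = 0.
    rewrite /exp_moment; under eq_Rintegral do rewrite mul0r.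
    by rewrite Rintegral_cst// mul0r.
  rewrite sub0r mulNr opprK; case: eqVneq => [->|/Ej->]; last by rewrite mulr0.
  by rewrite mulVf// -normr_gt0.
Qed.

End annihilation.

(** * Cost of the biorthogonal functions *)

Section counting_sums.
Context (R : realType).

(** When P holds at the last index n, the trivial bound n + 1 on the count is already at most y. *)
Lemma sum_pred_le (P : pred nat) (y : R) n : 0 <= y ->
  (forall i, P i -> i.+1%:R <= y) -> \sum_(i < n) (P i)%:R <= y.
Proof.
move=> y0 Py; have triv m : \sum_(i < m) (P i)%:R <= m%:R :> R.
  rewrite -[leRHS](@mulr1 R) -[m in leRHS]card_ord mulr_natl -sumr_const.
  by apply: ler_sum => i _; rewrite lern1 leq_b1.
elim: n => [|n IH]; first by rewrite big_ord0.
rewrite big_ord_recr/=; case: (boolP (P n)) => Pn; last by rewrite addr0.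
by rewrite (le_trans _ (Py _ Pn))// -[leRHS]natr1 lerD2r triv.
Qed.

Lemma sum_pred_dist_le (P : pred nat) k (y : R) n : 0 <= y ->
  (forall i, (i < k)%N -> P i -> (k - i)%:R <= y) ->
  (forall i, (k < i)%N -> P i -> (i - k)%:R <= y) ->
  \sum_(i < n) ((i != k :> nat) && P i)%:R <= 2 * y.
Proof.
move=> y0 Pl Pr; pose G n : R := \sum_(i < n) ((i != k :> nat) && P i)%:R.
(* Left of k, an index m with P m satisfies k - m <= y, so counting starts only at distance y from
   k. *)
have Gl m : (m <= k)%N -> G m <= Num.max 0 (y - (k - m)%:R).
  elim: m => [|m IH] mk; first by rewrite /G big_ord0 le_max lexx.
  rewrite /G big_ord_recr/= -/(G m) ltn_eqF//=.
  have km : (k - m)%:R = (k - m.+1)%:R + 1 :> R by rewrite -subnSK// natr1.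
  have := IH (ltnW mk); rewrite km; case: (boolP (P m)) => Pm.
    have := Pl _ mk Pm; rewrite km => h.
    by rewrite !le_max => /orP[?|?]; apply/orP; right; rewrite /=; lra.
  rewrite !le_max => /orP[?|?]; apply/orP; [left|right]; rewrite /=; lra.
have Gk : G k <= y by have := Gl k (leqnn k); rewrite subnn le_max => /orP[|]; lra.
(* Both bounds are carried together: when P holds at k + 1 + d, its distance d + 1 is at most y, so
   the second bound y + d + 1 restores the first one. *)
have Gr d : G (k.+1 + d)%N <= 2 * y /\ G (k.+1 + d)%N <= y + d%:R.
  elim: d => [|d [h1 h2]].
    by rewrite addn0 /G big_ord_recr/= -/(G k) eqxx/= addr0; split; lra.
  rewrite addnS /G big_ord_recr/= -/(G (k.+1 + d)%N).
  have kd : (k < k.+1 + d)%N by rewrite addSn ltnS leq_addr.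
  have d1 : d.+1%:R = d%:R + 1 :> R by rewrite natr1.
  rewrite gtn_eqF//=; case: (boolP (P _)) => Pm; last by split => /=; lra.
  by have := Pr _ kd Pm; rewrite addSn subSn ?leq_addr// addKn => ?; split => /=; lra.
rewrite -/(G n); have [nk|kn] := leqP n k.
  by have := Gl _ nk; rewrite le_max => /orP[|]; have := ler0n R (k - n); lra.
by have [] := Gr (n - k.+1)%N; rewrite subnKC.
Qed.

(* Since w n = (n + 1)^(1/5), this bounds the sum of (n + 1)^(-6/5), by
   comparison with the telescoping series of the differences of 5 / w. *)
Lemma sum_inv_sixth_le (w : nat -> R) n : (forall i, 0 < w i) ->
  (forall i, w i ^+ 5 = i.+1%:R) -> \sum_(i < n) (w i)^-1 ^+ 6 <= 6.
Proof.
move=> w0 w5.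
have w01 : w 0%N = 1.
  by apply: (@pexpIrn _ 5) => //; rewrite ?nnegrE ?ltW ?ltr01// w5 expr1n.
suff S m : \sum_(i < m.+1) (w i)^-1 ^+ 6 <= 6 - 5 / w m.
  case: n => [|n]; first by rewrite big_ord0.
  by rewrite (le_trans (S n))// lerBlDr lerDl divr_ge0// ltW.
elim: m => [|m IH]; first by rewrite big_ord_recr big_ord0/= w01 invr1 expr1n; lra.
rewrite big_ord_recr/=; set u := w m in IH *; set v := w m.+1.
have u0 : 0 < u := w0 _; have v0 : 0 < v := w0 _.
have uv5 : v ^+ 5 - u ^+ 5 = 1 by rewrite /u /v !w5 -natr1; ring.
have uv : u <= v.
  by rewrite -(@ler_pXn2r _ 5) ?nnegrE ?ltW//; lra.
(* Write 1 as v^5 - u^5 and factor out v - u: the cofactor is at most 5 v^4. *)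
have h : v^-1 ^+ 6 <= 5 * (u^-1 - v^-1).
  have -> : u^-1 - v^-1 = (v - u) / (u * v) by field; rewrite !gt_eqF.
  rewrite exprVn -div1r mulrA ler_pdivrMr ?exprn_gt0//.
  rewrite mulrAC ler_pdivlMr ?mulr_gt0// -[X in X * (u * v)]uv5.
  have -> : v ^+ 5 - u ^+ 5 =
    (v - u) * (v ^+ 4 + v ^+ 3 * u + v ^+ 2 * u ^+ 2 + v * u ^+ 3 + u ^+ 4) by ring.
  have -> : 5 * (v - u) * v ^+ 6 = (v - u) * (5 * v ^+ 4 * (v * v)) by ring.
  rewrite -mulrA ler_wpM2l ?subr_ge0//.
  have [u0' v0'] := (ltW u0, ltW v0).
  apply: ler_pM; rewrite ?mulr_ge0 ?addr_ge0 ?exprn_ge0 ?mulr_ge0 ?exprn_ge0 ?ler_wpM2r//.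
  have uXv j : u ^+ j <= v ^+ j by rewrite lerXn2r ?nnegrE.
  have v3 : v ^+ 3 * u <= v ^+ 4 by rewrite [leRHS]exprSr ler_wpM2l// exprn_ge0.
  have v2 : v ^+ 2 * u ^+ 2 <= v ^+ 4.
    by rewrite [leRHS](exprD v 2 2) ler_wpM2l// exprn_ge0.
  have v1 : v * u ^+ 3 <= v ^+ 4 by rewrite [leRHS]exprS ler_wpM2l.
  by have := uXv 4%N; lra.
lra.
Qed.

(** Since 1 - e^(-x) is the inverse of 1 + 1 / (e^x - 1), it suffices to use e^x - 1 >= x^3 / 6 and
    1 + y <= e^y. The cube is chosen because x will be of order T m_i^2, so that the loss is a
    multiple of the summable m_i^(-6). *)
Lemma one_sub_expRN_ge_cube (x : R) : 0 < x ->
  expR (- (6 / x ^+ 3)) <= 1 - expR (- x).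
Proof.
move=> x0; have x3 : 0 < x ^+ 3 / 6 by rewrite divr_gt0// exprn_gt0.
have ex : x ^+ 3 / 6 <= expR x - 1.
  by have := expR_ge1Dxn 2 (ltW x0); rewrite -[3`!]/6%N; lra.
rewrite [in leRHS]expRN (_ : 6 / x ^+ 3 = (x ^+ 3 / 6)^-1); last by rewrite invf_div.
have e0 := expR_gt0 x; have e1 : 0 < expR x - 1 by lra.
have -> : 1 - (expR x)^-1 = (1 + (expR x - 1)^-1)^-1.
  by field; rewrite subrK !gt_eqF.
rewrite expRN lef_pV2 ?posrE ?expR_gt0 ?addr_gt0 ?invr_gt0//.
rewrite (le_trans _ (expR_ge1Dx _))// lerD2l lef_pV2 ?posrE//.
Qed.

Lemma one_sub_expRN_ge_inv (x : R) : 0 < x -> (1 + x^-1)^-1 <= 1 - expR (- x).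
Proof.
move=> x0; have -> : (1 + x^-1)^-1 = 1 - (1 + x)^-1.
  by field; rewrite !gt_eqF ?addr_gt0.
by rewrite lerB// expRN lef_pV2 ?posrE ?expR_gt0 ?addr_gt0// expR_ge1Dx.
Qed.

End counting_sums.

(** * Lower bounds for the products over the spectrum *)

Section cost.
Context (R : realType) (mu m : nat -> R) (K b cw S : R).
Hypotheses (mu_incr : increasing_seq mu) (m1 : forall i, 1 <= m i)
  (m8 : forall i, m i ^+ 8 = mu i).
Hypotheses (K0 : 0 < K) (rank_le : forall i, i.+1%:R <= K * m i ^+ 5).
Hypothesis cluster_le : forall i j, (i <= j)%N -> mu j <= mu i + 1 ->
  (j - i)%:R <= K * mu i `^ b.
Hypotheses (b0 : 0 <= b) (cw0 : 0 < cw).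
Hypothesis mu_gap : forall i, expR (- cw * m i ^+ 4) <= mu i.+1 - mu i.
Hypotheses (S1 : 1 <= S) (sum_m : forall n, \sum_(i < n) (m i)^-1 ^+ 6 <= S).

Let m0 i : 0 < m i. Proof. exact: lt_le_trans (m1 i). Qed.
Let mge0 i : 0 <= m i. Proof. exact: ltW. Qed.
Let mu1 i : 1 <= mu i. Proof. by rewrite -m8 exprn_ege1. Qed.
Let mu_ge0 i : 0 <= mu i. Proof. exact: le_trans (mu1 i). Qed.
Let S0 : 0 < S. Proof. exact: lt_le_trans S1. Qed.

Lemma mu_homo i j : (i <= j)%N -> mu i <= mu j.
Proof. by move=> ij; rewrite mu_incr. Qed.

Lemma m_homo i j : (i <= j)%N -> m i <= m j.
Proof.
by move=> /mu_homo; rewrite -!m8 ler_pXn2r ?nnegrE.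
Qed.

(** For i < k the gap following i is used: its lower bound exceeds the one at k since e^(- cw m^4)
    decreases with m. *)
Lemma gap_dist i k : i != k -> expR (- cw * m k ^+ 4) <= `|mu i - mu k|.
Proof.
rewrite neq_ltn => /orP[ik|ki].
  rewrite distrC (le_trans _ (ler_norm _))//.
  have h : mu i.+1 - mu i <= mu k - mu i by rewrite lerB// mu_homo.
  rewrite (le_trans _ h)// (le_trans _ (mu_gap i))// ler_expR !mulNr lerN2.
  by rewrite (ler_wpM2l (ltW cw0))// lerXn2r ?nnegrE// m_homo// ltnW.
rewrite (le_trans _ (ler_norm _))// (le_trans (mu_gap k))// lerB// mu_homo//.
Qed.

(* That is T / (4 S) * mu i `^ (- 3 / 4): summable because the counting exponent
   is at most 5 / 8, while mu i * delay T i still tends to +oo. *)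
Definition delay T (i : nat) : R := T / (4 * S) * (m i)^-1 ^+ 6.

Let S4 : 0 < 4 * S. Proof. by rewrite mulr_gt0. Qed.
Let mV6 i : 0 < (m i)^-1 ^+ 6. Proof. by rewrite exprn_gt0// invr_gt0. Qed.

Lemma delay_gt0 T i : 0 < T -> 0 < delay T i.
Proof. by move=> T0; rewrite mulr_gt0// divr_gt0. Qed.

Lemma sum_delay T n : 0 <= T -> \sum_(i < n) delay T i <= T / 4.
Proof.
move=> T0; rewrite -mulr_sumr (_ : T / 4 = T / (4 * S) * S).
  by rewrite ler_wpM2l// divr_ge0// mulr_ge0 ?(ltW S0).
by field; rewrite gt_eqF.
Qed.

Lemma mu_delay T i : mu i * delay T i = T / (4 * S) * m i ^+ 2.
Proof. by rewrite /delay -m8; field; rewrite !gt_eqF. Qed.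

(** With x = mu_i tau_i = T m_i^2 / (4 S), the bound e^(-x) <= 6 / x^3 produces the summable weight
    m_i^(-6). *)
Lemma sum_expRN_delay T n : 0 < T ->
  \sum_(i < n) expR (- (mu i * delay T i)) <= 6 * (4 * S) ^+ 3 * S / T ^+ 3.
Proof.
move=> T0.
apply: (@le_trans _ _ (\sum_(i < n) (6 * (4 * S) ^+ 3 / T ^+ 3 * (m i)^-1 ^+ 6))).
  apply: ler_sum => i _; rewrite mu_delay; set x := _ * _.
  have x0 : 0 < x by rewrite mulr_gt0 ?exprn_gt0// divr_gt0.
  have -> : 6 * (4 * S) ^+ 3 / T ^+ 3 * (m i)^-1 ^+ 6 = (x ^+ 3 / 6)^-1.
    by rewrite /x; field; rewrite !gt_eqF.
  rewrite expRN lef_pV2 ?posrE ?expR_gt0 ?divr_gt0 ?exprn_gt0//.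
  by have := expR_ge1Dxn 2 (ltW x0); rewrite -[3`!]/6%N; lra.
rewrite -mulr_sumr [leRHS]mulrAC ler_wpM2l//.
by rewrite divr_ge0 ?mulr_ge0 ?exprn_ge0// ltW.
Qed.

(** Minus the logarithm of the lower bound on the product. The three terms come from all the
    indices, from the at most 2 K m_k^5 indices with mu_i < 2 mu_k, and from the cluster at distance
    less than 1 of mu_k, counted on both sides. [X] stands for a common upper bound of m_k and
    T^(-1/2). *)
Definition log_cost (C2 X T : R) k : R :=
  48 * (4 * S) ^+ 3 * S / T ^+ 3 + 2 * K * m k ^+ 5 * (C2 * X)
  + 2 * (K * mu k `^ b) * (cw * m k ^+ 4).

Let fact8S : 1 <= 8`!%:R * (8 * S).
Proof.
have S8 : 1 <= 8 * S by rewrite mulr_ege1// ler1n.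
by apply: mulr_ege1 => //; rewrite ler1n fact_gt0.
Qed.

(* If mu i >= 2 mu k then x := |mu i - mu k| * delay T i is of order T m_i ^ 2 and
   the cubic bound yields a summable loss. The other factors lose at most 1 + 1 / x,
   that is a power X ^ 8, absorbed in expR (C X), times the inverse of the gap for
   the i such that |mu i - mu k| < 1. *)
Lemma factor_ge T X k i : 0 < T -> m k <= X -> 1 / T <= X ^+ 2 -> i != k ->
  expR (- (48 * (4 * S) ^+ 3 / T ^+ 3 * (m i)^-1 ^+ 6
    + (mu i < 2 * mu k)%R%:R * (8`!%:R * (8 * S) * X)
    + (`|mu i - mu k| < 1)%R%:R * (cw * m k ^+ 4)))
  <= 1 - expR (- (`|mu i - mu k| * delay T i)).
Proof.
move=> T0 kX TX ik; have t0 := delay_gt0 i T0.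
have X0 : 0 < X by exact: lt_le_trans kX.
have c0 : 0 <= cw * m k ^+ 4 by rewrite mulr_ge0 ?exprn_ge0// ltW.
set d := `|mu i - mu k|; set A := 48 * _ / _ * _.
have A0 : 0 <= A.
  by rewrite mulr_ge0 ?(ltW (mV6 i))// divr_ge0 ?mulr_ge0 ?exprn_ge0// ltW.
have d_gap : expR (- cw * m k ^+ 4) <= d by exact: gap_dist.
have d0 : 0 < d by rewrite (lt_le_trans _ d_gap)// expR_gt0.
case: ltP => [iltk|klei]; last first.
  rewrite mul0r addr0.
  have di : mu i / 2 <= d by rewrite (le_trans _ (ler_norm _))//; lra.
  have y0 : 0 < mu i / 2 * delay T i.
    by rewrite mulr_gt0// divr_gt0// (lt_le_trans _ (mu1 i)).
  apply: (@le_trans _ _ (1 - expR (- (mu i / 2 * delay T i)))); last first.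
    by rewrite lerB// ler_expR lerN2 ler_wpM2r// ltW.
  apply: (le_trans _ (one_sub_expRN_ge_cube y0)); rewrite ler_expR lerN2.
  rewrite (_ : 6 / _ = A); first by rewrite lerDl mulr_ge0.
  rewrite mulrAC mu_delay /A; field.
  by rewrite !gt_eqF.
have x0 : 0 < d * delay T i by rewrite mulr_gt0.
apply: (le_trans _ (one_sub_expRN_ge_inv x0)); rewrite expRN.
rewrite lef_pV2 ?posrE ?expR_gt0 ?addr_gt0 ?invr_gt0// mul1r.
(* Otherwise m_i > m_k, and multiplying m_i^6 > 2 m_k^6 by m_i^2 >= m_k^2 contradicts mu_i < 2
   mu_k. *)
have mi6 : m i ^+ 6 <= 2 * m k ^+ 6.
  rewrite leNgt; apply/negP => h6.
  have km : m k <= m i.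
    rewrite leNgt; apply/negP => mik.
    have : m i ^+ 6 <= m k ^+ 6 by rewrite lerXn2r ?nnegrE// ltW.
    by have : 0 <= m k ^+ 6 by [rewrite exprn_ge0]; lra.
  move: iltk; rewrite -!m8 ltNge => /negP; apply.
  rewrite (exprD (m i) 6 2) (exprD (m k) 6 2) mulrA ler_pM// ?mulr_ge0 ?exprn_ge0//.
    exact: ltW.
  by rewrite lerXn2r ?nnegrE.
have inv_x : (d * delay T i)^-1 <= d^-1 * (8 * S * X ^+ 8).
  rewrite invfM ler_wpM2l ?invr_ge0 ?(ltW d0)//.
  have -> : (delay T i)^-1 = 4 * S * (1 / T * m i ^+ 6).
    by rewrite /delay; field; rewrite !gt_eqF.
  have -> : 8 * S * X ^+ 8 = 4 * S * (X ^+ 2 * (2 * X ^+ 6)) by ring.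
  rewrite ler_wpM2l ?mulr_ge0 ?(ltW S0)// ler_pM ?divr_ge0 ?exprn_ge0 ?(ltW T0)//.
  by rewrite (le_trans mi6)// ler_wpM2l// lerXn2r ?nnegrE// ltW.
(* Keep the eighth-order term of the exponential. The factor 8! in the constant cancels its
   denominator, and the constant, being at least 1, is below its eighth power. *)
have C8 : 1 + 8 * S * X ^+ 8 <= expR (8`!%:R * (8 * S) * X).
  have C0 := fact8S.
  have CX0 : 0 <= 8`!%:R * (8 * S) * X by rewrite mulr_ge0 ?(ltW X0)// (le_trans _ C0).
  have := @expR_ge1Dxn R (8`!%:R * (8 * S) * X) 7 CX0.
  apply: le_trans; rewrite lerD2l exprMn [leRHS]mulrAC ler_wpM2r ?exprn_ge0 ?(ltW X0)//.
  rewrite ler_pdivlMr// mulrC.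
  by rewrite exprS ler_peMr ?exprn_ege1// (le_trans _ C0).
have dn : d^-1 <= expR ((d < 1)%R%:R * (cw * m k ^+ 4)).
  case: ltP => d1; last by rewrite mul0r expR0 invf_le1.
  rewrite mul1r -[leRHS]invrK -expRN lef_pV2 ?posrE ?expR_gt0//.
  by rewrite -mulNr.
have e1 : 1 <= expR ((d < 1)%R%:R * (cw * m k ^+ 4)).
  by rewrite -[leLHS]expR0 ler_expR mulr_ge0.
rewrite -addrA expRD.
apply: (@le_trans _ _ (expR (8`!%:R * (8 * S) * X + (d < 1)%R%:R * (cw * m k ^+ 4))));
    last first.
  by rewrite ler_peMl ?expR_ge0// -[leLHS]expR0 ler_expR.
rewrite expRD [leRHS]mulrC (le_trans _ (ler_wpM2l _ C8)) ?expR_ge0//.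
rewrite mulrDr mulr1 lerD// (le_trans inv_x)// ler_wpM2r//.
by rewrite !mulr_ge0 ?exprn_ge0 ?(ltW S0) ?(ltW X0).
Qed.

(** The losses of the individual factors add up in the exponent; the two indicators in them become
    the counts given by [rank_le] and [cluster_le]. *)
Lemma prod_ge T X k n : 0 < T -> m k <= X -> 1 / T <= X ^+ 2 ->
  expR (- log_cost (8`!%:R * (8 * S)) X T k) <=
  \prod_(i < n | i != k :> nat) (1 - expR (- (`|mu i - mu k| * delay T i))).
Proof.
move=> T0 kX TX.
pose E i := 48 * (4 * S) ^+ 3 / T ^+ 3 * (m i)^-1 ^+ 6
    + (mu i < 2 * mu k)%R%:R * (8`!%:R * (8 * S) * X)
    + (`|mu i - mu k| < 1)%R%:R * (cw * m k ^+ 4).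
have X0 : 0 < X by exact: lt_le_trans kX.
have c0 : 0 <= cw * m k ^+ 4 by rewrite mulr_ge0 ?exprn_ge0// ltW.
have CX0 : 0 <= 8`!%:R * (8 * S) * X by rewrite !mulr_ge0 ?(ltW S0) ?(ltW X0).
apply: (@le_trans _ _ (\prod_(i < n | i != k :> nat) expR (- E i))); last first.
  apply: ler_prod => i ik; rewrite expR_ge0/=; exact: factor_ge.
rewrite -expR_sum ler_expR sumrN lerN2.
apply: (@le_trans _ _ (\sum_(i < n) (48 * (4 * S) ^+ 3 / T ^+ 3 * (m i)^-1 ^+ 6)
   + \sum_(i < n) ((mu i < 2 * mu k)%R%:R * (8`!%:R * (8 * S) * X))
   + \sum_(i < n) (((i != k :> nat) && (`|mu i - mu k| < 1)%R)%:R * (cw * m k ^+ 4)))).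
  rewrite -!big_split/= big_mkcond/=; apply: ler_sum => i _.
  case: ifP => ik //=.
  have A0 : 0 <= 48 * (4 * S) ^+ 3 / T ^+ 3 * (m i)^-1 ^+ 6.
    by rewrite mulr_ge0 ?(ltW (mV6 i))// divr_ge0 ?mulr_ge0 ?exprn_ge0// ltW.
  by rewrite mul0r addr0 addr_ge0// mulr_ge0.
rewrite /log_cost; apply: lerD; first apply: lerD.
- rewrite -mulr_sumr [leRHS]mulrAC ler_wpM2l//.
  by rewrite divr_ge0 ?mulr_ge0 ?exprn_ge0// ltW.
- rewrite -mulr_suml ler_wpM2r//.
  apply: (@sum_pred_le R (fun i => mu i < 2 * mu k)).
    by rewrite !mulr_ge0 ?exprn_ge0// ltW.
  move=> i ik; rewrite (le_trans (rank_le i))//.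
  have -> : 2 * K * m k ^+ 5 = K * (2 * m k ^+ 5) by ring.
  rewrite (ler_wpM2l (ltW K0))//.
  have [mk|mk] := leP (m i) (m k).
    have h : m i ^+ 5 <= m k ^+ 5 by rewrite lerXn2r ?nnegrE.
    by have : 0 <= m k ^+ 5 by [rewrite exprn_ge0]; lra.
  move: ik; apply: contraLR; rewrite -!ltNge -!m8 => h.
  rewrite -leNgt (exprD (m i) 5 3) (exprD (m k) 5 3) mulrA ler_pM ?mulr_ge0 ?exprn_ge0//.
    exact: ltW.
  by rewrite lerXn2r ?nnegrE// ltW.
- rewrite -mulr_suml ler_wpM2r//.
  have y0 : 0 <= K * mu k `^ b by rewrite mulr_ge0 ?powR_ge0// ltW.
  apply: (@sum_pred_dist_le R (fun i => `|mu i - mu k| < 1)) => //.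
    move=> i ik ik1; rewrite (le_trans (cluster_le (ltnW ik) _))//.
      by move: ik1; rewrite distrC => /(le_lt_trans (ler_norm _)); lra.
    rewrite (ler_wpM2l (ltW K0))// ge0_ler_powR// ?nnegrE//.
    exact/mu_homo/ltnW.
  move=> i ki ik1; rewrite cluster_le// 1?ltnW//.
  by move: ik1 => /(le_lt_trans (ler_norm _)); lra.
Qed.

Let m_powR i n : m i ^+ n = mu i `^ (n%:R / 8).
Proof.
have -> : mu i = m i `^ 8%:R by rewrite powR_mulrn// m8.
by rewrite -powRrM mulrC divfK// powR_mulrn.
Qed.

(** Take X = max (m_k, T^(-1/2)): then m_k^5 X <= X^6 <= m_k^6 + T^(-3), and m_k^6 = mu_k^(3/4). The
    cluster term is of order mu_k^(b + 1/2). These two powers are the origin of the conditions on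
    [theta]. *)
Lemma log_cost_le theta T k : 0 < T -> 3 / 4 <= theta -> 1 / 2 + b <= theta ->
  exists X, [/\ m k <= X, 1 / T <= X ^+ 2 & log_cost (8`!%:R * (8 * S)) X T k <=
    (48 * (4 * S) ^+ 3 * S + 2 * K * (8`!%:R * (8 * S))) / T ^+ 3
    + (2 * K * (8`!%:R * (8 * S)) + 2 * K * cw) * mu k `^ theta].
Proof.
move=> T0 th1 th2; set C2 := 8`!%:R * _.
have C20 : 0 < C2 by rewrite (lt_le_trans _ fact8S).
clearbody C2; have T1 : 0 <= 1 / T by rewrite divr_ge0// ltW.
exists (Num.max (m k) (Num.sqrt (1 / T))); set X := Num.max _ _.
have mX : m k <= X by rewrite le_max lexx.
have sX : Num.sqrt (1 / T) <= X by rewrite le_max lexx orbT.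
have X0 : 0 <= X by rewrite (le_trans (mge0 k)).
split => //; first by rewrite -[leLHS]sqr_sqrtr// lerXn2r ?nnegrE ?sqrtr_ge0.
have X6 : X ^+ 6 <= m k ^+ 6 + 1 / T ^+ 3.
  rewrite /X maxEle; case: ifP => _.
    rewrite (exprM _ 2 3) sqr_sqrtr// expr_div_n expr1n lerDr exprn_ge0//.
  by rewrite lerDl divr_ge0// exprn_ge0// ltW.
have mX5 : m k ^+ 5 * X <= X ^+ 6.
  by rewrite [leRHS]exprSr ler_wpM2r// lerXn2r ?nnegrE.
have e6 : m k ^+ 6 <= mu k `^ theta.
  by rewrite m_powR ler_powR//; lra.
have e4 : mu k `^ b * m k ^+ 4 <= mu k `^ theta.
  rewrite m_powR -powRD; last by rewrite implybE orbC gt_eqF// (lt_le_trans _ (mu1 k)).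
  by rewrite ler_powR//; lra.
rewrite /log_cost.
have h1 : 2 * K * C2 * (m k ^+ 5 * X) <= 2 * K * C2 * (mu k `^ theta + 1 / T ^+ 3).
  by rewrite ler_wpM2l ?mulr_ge0 ?(ltW K0) ?(ltW C20)//; lra.
have h2 : 2 * K * cw * (mu k `^ b * m k ^+ 4) <= 2 * K * cw * mu k `^ theta.
  by rewrite ler_wpM2l// !mulr_ge0 ?(ltW K0) ?(ltW cw0).
have -> : 2 * K * m k ^+ 5 * (C2 * X) = 2 * K * C2 * (m k ^+ 5 * X) by ring.
have -> : 2 * (K * mu k `^ b) * (cw * m k ^+ 4) = 2 * K * cw * (mu k `^ b * m k ^+ 4) by ring.
lra.
Qed.

Lemma biorthogonal_family theta : 3 / 4 <= theta -> 1 / 2 + b <= theta ->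
  exists2 C, 0 < C & forall T k, 0 < T < 1 ->
  exists q : R -> R, [/\ continuous q, (forall s, q s != 0 -> 0 <= s <= T),
    (forall s, `|q s| <= C * expR (C / T ^+ 3 + C * mu k `^ theta - mu k * (T / 2))) &
    forall j, exp_moment T (mu j) q = (j == k)%:R].
Proof.
move=> th1 th2.
pose C2 : R := 8`!%:R * (8 * S).
have C20 : 0 < C2 by rewrite (lt_le_trans _ fact8S).
(* 54 = 48 + 6: the first term of [log_cost] plus the growth of the sup norm under annihilation. *)
pose P := 54 * (4 * S) ^+ 3 * S.
have P0 : 0 <= P by rewrite /P !mulr_ge0 ?exprn_ge0 ?(ltW S4) ?(ltW S0).
have KC0 : 0 < K * C2 by rewrite mulr_gt0.
have Kw0 : 0 < K * cw by rewrite mulr_gt0.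
pose C := 16 + P + 2 * K * C2 + 2 * K * cw.
exists C; first by rewrite /C; lra.
move=> T k /andP[T0 T1].
have [X [kX TX cost]] := log_cost_le k T0 th1 th2.
have [q [cq q0 qb qm]] := @biorthogonal_element R T mu (delay T) k
   (expR (- log_cost C2 X T k)) (6 * (4 * S) ^+ 3 * S / T ^+ 3) T0 mu_ge0
   (fun i => ltW (delay_gt0 i T0)) (fun n => sum_delay n (ltW T0))
   (fun n => sum_expRN_delay n T0) (expR_gt0 _) (fun n => prod_ge n T0 kX TX).
exists q; split => // s; apply: (le_trans (qb s)).
have T3 : 0 < T ^+ 3 by rewrite exprn_gt0.
(* The prefactor 16 / T is split: 16 goes into the constant, 1 / T into the exponential. *)
have T1e : 1 / T <= expR (1 / T ^+ 3).
  apply: (@le_trans _ _ (1 / T ^+ 3)); last first.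
    by rewrite (le_trans _ (expR_ge1Dx _))// lerDr.
  by rewrite !div1r lef_pV2 ?posrE// exprS ger_pMr// exprn_ile1// ltW.
rewrite expRN invrK -!expRD -mulrA -expRD -mulrA.
apply: (@le_trans _ _ (16 * (expR (1 / T ^+ 3) *
   expR (6 * (4 * S) ^+ 3 * S / T ^+ 3 + log_cost C2 X T k - mu k * (T / 2))))).
  by rewrite ler_wpM2l// ler_wpM2r ?expR_ge0// -div1r.
have C16 : 16 <= C by rewrite /C; lra.
rewrite -expRD ler_pM ?expR_ge0//.
rewrite ler_expR; move: cost; rewrite -/C2.
set L := log_cost _ _ _ _; set V := mu k `^ theta; set W := T ^+ 3 in T3 *.
have V0 : 0 <= V by exact: powR_ge0.
have W0 : 0 <= W^-1 by rewrite invr_ge0 ltW.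
have KwW : 0 <= K * cw * W^-1 by rewrite mulr_ge0// ltW.
have PV : 0 <= P * V by rewrite mulr_ge0.
rewrite /C; move: PV; rewrite /P.
clearbody L V W; move: (C2) => c2.
by lra.
Qed.

End cost.

(** * Eigenvalue counts from the Weyl law *)

Section weyl.
Context (R : realType) (mu : nat -> R).
Hypothesis mu_incr : increasing_seq mu.

Lemma counting_fun_ge k (x : R) : mu k <= x ->
  (k.+1%:R%:E <= counting_fun mu x)%E.
Proof.
move=> kx; rewrite /counting_fun /counting; case: asboolP => [fin|_]; last exact: leey.
rewrite lee_fin ler_nat leq_card_fset_set//.
apply: subset_card_le => i /= ik.
by rewrite (le_trans _ kx)// mu_incr.
Qed.

Lemma counting_fun_eq k : counting_fun mu (mu k) = k.+1%:R%:E.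
Proof.
rewrite /counting_fun (_ : [set _ | _] = `I_k.+1); last first.
  by apply/seteqP; split => i /=; rewrite mu_incr.
rewrite /counting asboolT; last exact: finite_II.
by rewrite (@card_fset_set _ _ k.+1).
Qed.

Context (a b cW1 cW2 : R).
Hypotheses (a0 : 0 <= a) (a1 : a <= 1) (b0 : 0 <= b) (b1 : b <= 1) (ba : b <= a)
  (cW10 : 0 < cW1) (cW20 : 0 < cW2) (mu1 : 1 <= mu 0%N).
Hypothesis mu_weyl : forall x : R, mu 0%N <= x ->
    ((cW1 * x `^ a - cW2 * x `^ b)%:E <= counting_fun mu x)%E /\
    (counting_fun mu x <= (cW1 * x `^ a + cW2 * x `^ b)%:E)%E.

Let mu_ge1 k : 1 <= mu k.
Proof. by rewrite (le_trans mu1)// mu_incr. Qed.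

Let mu_ge0 k : 0 <= mu k. Proof. exact: le_trans (mu_ge1 k). Qed.

Lemma weyl_rank_le k : k.+1%:R <= (cW1 + cW2) * mu k `^ a.
Proof.
have mu0k : mu 0%N <= mu k by rewrite mu_incr.
have [_] := mu_weyl mu0k.
rewrite counting_fun_eq lee_fin => /le_trans; apply.
rewrite mulrDl lerD2l (ler_wpM2l (ltW cW20))//.
by rewrite ler_powR.
Qed.

(* The leading terms of the two-sided Weyl law differ by at most cW1 on an interval
   of length 1, so that only the remainder cW2 * x `^ b counts. *)
Lemma weyl_cluster_le i j : (i <= j)%N -> mu j <= mu i + 1 ->
  (j - i)%:R <= (cW1 + 3 * cW2) * mu i `^ b.
Proof.
move=> ij ji; have mu0i : mu 0%N <= mu i by rewrite mu_incr.
have [] := mu_weyl mu0i; rewrite counting_fun_eq lee_fin => hi _.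
have mu0i1 : mu 0%N <= mu i + 1 by rewrite (le_trans mu0i)// lerDl.
have [] := mu_weyl mu0i1.
move=> _ /(le_trans (counting_fun_ge ji)); rewrite lee_fin => hj.
have mi0 : 0 < mu i by rewrite (lt_le_trans _ (mu_ge1 i)).
(* Bernoulli: (1 + 1/mu)^r <= 1 + 1/mu for r <= 1. With r = a the increment mu^a / mu is at most 1;
   with r = b the power at most doubles, so the remainders at both ends total 3 cW2 mu^b. *)
have powD r : 0 <= r -> r <= 1 -> (mu i + 1) `^ r <= mu i `^ r * (1 + (mu i)^-1).
  move=> r0 r1; have -> : mu i + 1 = mu i * (1 + (mu i)^-1) by field; rewrite gt_eqF.
  rewrite powRM ?addr_ge0 ?invr_ge0// ler_wpM2l ?powR_ge0//.
  by rewrite ler1_powR// lerDl invr_ge0.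
have ha : (mu i + 1) `^ a <= mu i `^ a + 1.
  rewrite (le_trans (powD _ a0 a1))// mulrDr mulr1 lerD2l ler_pdivrMr// mul1r.
  by rewrite ler1_powR.
have hb : (mu i + 1) `^ b <= 2 * mu i `^ b.
  rewrite (le_trans (powD _ b0 b1))// [leRHS]mulrC ler_wpM2l ?powR_ge0//.
  have : (mu i)^-1 <= 1 by rewrite invf_le1.
  by lra.
have b1' : 1 <= mu i `^ b by rewrite -[leLHS](powRr0 (mu i)) ler_powR.
have ha' : cW1 * (mu i + 1) `^ a <= cW1 * (mu i `^ a + 1) by rewrite (ler_wpM2l (ltW cW10)).
have hb' : cW2 * (mu i + 1) `^ b <= cW2 * (2 * mu i `^ b) by rewrite (ler_wpM2l (ltW cW20)).
have h1 : cW1 * 1 <= cW1 * mu i `^ b by rewrite (ler_wpM2l (ltW cW10)).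
rewrite natrB//; move: hi hj; rewrite -!natr1; lra.
Qed.

End weyl.

(** Here m = mu^(1/8). The assumption a <= 5/8 turns the Weyl bound into k + 1 <= K m_k^5; the lower
    bound on a guarantees b <= a, so that the remainder is absorbed by the leading term. *)
Lemma biorthogonal_family_weyl (R : realType) (mu : nat -> R) (a b cW1 cW2 cw theta : R) :
  1 / 2 <= a <= 5 / 8 -> 0 < b < 1 / 2 -> 0 < cW1 -> 0 < cW2 -> 0 < cw ->
  increasing_seq mu -> 1 <= mu 0%N ->
  (forall x : R, mu 0%N <= x ->
    ((cW1 * x `^ a - cW2 * x `^ b)%:E <= counting_fun mu x)%E /\
    (counting_fun mu x <= (cW1 * x `^ a + cW2 * x `^ b)%:E)%E) ->
  (forall k : nat, expR (- cw * mu k `^ (1 / 2)) <= mu k.+1 - mu k) ->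
  3 / 4 <= theta -> 1 / 2 + b <= theta ->
  exists2 C, 0 < C & forall T k, 0 < T < 1 ->
  exists q : R -> R, [/\ continuous q, (forall s, q s != 0 -> 0 <= s <= T),
    (forall s, `|q s| <= C * expR (C / T ^+ 3 + C * mu k `^ theta - mu k * (T / 2))) &
    forall j, exp_moment T (mu j) q = (j == k)%:R].
Proof.
move=> /andP[a1 a2] /andP[b1 b2] c1 c2 cw0 incr mu1 weyl gap th1 th2.
have mu_ge1 k : 1 <= mu k by rewrite (le_trans mu1)// incr.
have mu_ge0 k : 0 <= mu k by exact: le_trans (mu_ge1 k).
pose m k := mu k `^ (1 / 8).
have mX k n : m k ^+ n = mu k `^ (n%:R / 8).
  by rewrite -powR_mulrn ?powR_ge0// -powRrM; congr powR; field.
have m1 k : 1 <= m k by rewrite -[leLHS](powRr0 (mu k)) ler_powR.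
have m0 k : 0 < m k by exact: lt_le_trans (m1 k).
have m8 k : m k ^+ 8 = mu k by rewrite mX divff// powRr1.
pose K := cW1 + 3 * cW2.
have K0 : 0 < K by rewrite /K; lra.
have rank k : k.+1%:R <= K * m k ^+ 5.
  apply: (@le_trans _ _ ((cW1 + cW2) * mu k `^ a)).
    by apply: (@weyl_rank_le _ _ incr a b) => //; lra.
  rewrite ler_pM ?powR_ge0 ?addr_ge0 ?(ltW c1) ?(ltW c2)//; first by rewrite /K; lra.
  by rewrite mX ler_powR//; lra.
have cluster i j : (i <= j)%N -> mu j <= mu i + 1 -> (j - i)%:R <= K * mu i `^ b.
  by apply: (@weyl_cluster_le _ _ incr a) => //; lra.
have gap' k : expR (- cw * m k ^+ 4) <= mu k.+1 - mu k.
  rewrite mX (_ : 4 / 8 = 1 / 2)//; by field.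
(* Taking fifth roots in k + 1 <= K m_k^5 compares m_k with (k + 1)^(1/5), whence the value of
   [S]. *)
pose w k : R := k.+1%:R `^ (1 / 5).
have w0 k : 0 < w k by rewrite powR_gt0.
have w5 k : w k ^+ 5 = k.+1%:R.
  by rewrite -powR_mulrn ?powR_ge0// -powRrM (_ : 1 / 5 * 5 = 1) ?powRr1//; field.
pose kap := K `^ (1 / 5).
have kap0 : 0 < kap by rewrite powR_gt0.
have kap5 : kap ^+ 5 = K.
  by rewrite -powR_mulrn ?powR_ge0// -powRrM (_ : 1 / 5 * 5 = 1) ?powRr1 ?(ltW K0)//; field.
have wm k : w k <= kap * m k.
  rewrite -(@ler_pXn2r _ 5) ?nnegrE ?mulr_ge0 ?(ltW kap0) ?(ltW (m0 _)) ?(ltW (w0 _))//.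
  by rewrite w5 exprMn kap5.
pose S := 1 + 6 * kap ^+ 6.
have S1 : 1 <= S by rewrite /S lerDl mulr_ge0// exprn_ge0// ltW.
have sumS n : \sum_(i < n) (m i)^-1 ^+ 6 <= S.
  apply: (@le_trans _ _ (\sum_(i < n) kap ^+ 6 * (w i)^-1 ^+ 6)).
    apply: ler_sum => i _; rewrite -exprMn lerXn2r ?nnegrE ?mulr_ge0 ?invr_ge0
      ?(ltW kap0) ?(ltW (m0 _)) ?(ltW (w0 _))//.
    by rewrite ler_pdivlMr// mulrC ler_pdivrMr.
  rewrite -mulr_sumr /S mulrC (le_trans (ler_wpM2r _ (sum_inv_sixth_le n w0 w5)))//.
    by rewrite exprn_ge0// ltW.
  by rewrite lerDr.
exact: (biorthogonal_family incr m1 m8 K0 rank cluster (ltW b1) cw0 gap' S1 sumS th1 th2).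
Qed.

(** * Synthesis of the control *)

Section control.
Context (R : realType).

(* Split according to whether y `^ e exceeds 8 A / T. *)
Lemma powR_absorb (A e : R) : 0 < A -> 0 < e < 1 ->
  exists2 A', 0 < A' & forall T y, 0 < T -> 0 < y ->
    A * y `^ (1 - e) <= y * T / 8 + A' / T `^ ((1 - e) / e).
Proof.
move=> A0 /andP[e0 e1]; have eN0 : e != 0 by rewrite gt_eqF.
exists (A * (8 * A) `^ ((1 - e) / e)); first by rewrite mulr_gt0// powR_gt0// mulr_gt0.
move=> T y T0 y0; have ye0 : 0 < y `^ e by exact: powR_gt0.
have T8 : 0 <= y * T / 8 by rewrite divr_ge0// mulr_ge0// ltW.
have [h|h] := leP (8 * A / T) (y `^ e).
  apply: (@le_trans _ _ (y * T / 8)); last first.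
    by rewrite lerDl !mulr_ge0 ?invr_ge0 ?powR_ge0// ltW.
  have -> : y `^ (1 - e) = y / y `^ e by rewrite powRB ?powRr1 ?(ltW y0)// implybE gt_eqF ?orbT.
  move: h; rewrite ler_pdivrMr// => h.
  rewrite mulrCA -mulrA (ler_wpM2l (ltW y0))// ler_pdivrMr// mulrAC ler_pdivlMr//.
  by rewrite mulrC [T * _]mulrC.
apply: (@le_trans _ _ (A * (8 * A) `^ ((1 - e) / e) / T `^ ((1 - e) / e))); last by rewrite lerDr.
rewrite -mulrA ler_wpM2l ?(ltW A0)//; set r := (1 - e) / e.
have -> : 1 - e = e * r by rewrite mulrC divfK.
rewrite powRrM -powRN; apply: (@le_trans _ _ ((8 * A / T) `^ r)).
  by rewrite ge0_ler_powR ?nnegrE ?(ltW ye0) ?(ltW h)// ?divr_ge0 ?mulr_ge0 ?(ltW A0)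
    ?(ltW T0) ?(ltW e0)//; lra.
rewrite powRM ?invr_ge0 ?mulr_ge0 ?(ltW A0) ?(ltW T0)//.
by rewrite -powR_inv1 ?(ltW T0)// -powRrM mulN1r.
Qed.

Lemma sum_inv_sqr_le n : \sum_(i < n) (i.+1%:R : R)^-1 ^+ 2 <= 2.
Proof.
suff S m : \sum_(i < m.+1) (i.+1%:R : R)^-1 ^+ 2 <= 2 - m.+1%:R^-1.
  case: n => [|n]; first by rewrite big_ord0.
  by rewrite (le_trans (S n))// lerBlDr lerDl invr_ge0.
elim: m => [|m IH]; first by rewrite big_ord_recr big_ord0/= invr1 expr1n; lra.
rewrite big_ord_recr/=; set y : R := m.+1%:R in IH *.
have y0 : 0 < y by rewrite ltr0n.
have -> : m.+2%:R = y + 1 by rewrite natr1.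
clearbody y; suff : (y + 1)^-1 ^+ 2 <= y^-1 - (y + 1)^-1 by lra.
have -> : y^-1 - (y + 1)^-1 = y^-1 * (y + 1)^-1 by field; rewrite !gt_eqF// addr_gt0.
rewrite expr2 ler_wpM2r ?invr_ge0 ?addr_ge0 ?(ltW y0)//.
by rewrite lef_pV2 ?posrE ?addr_gt0// lerDl.
Qed.

(** The control is the sum of the (x_k / beta_k) q_k. The decay e^(- mu_k T / 2) is shared out: T /
    8 absorbs mu_k^(1 - eps), T / 8 absorbs the exponent of 1 / beta_k, and the remaining T / 4
    makes the series converge. *)
Lemma moment_control (mu beta : nat -> R) (eps delta alpha K CB C1 : R) :
  0 < eps < 1 -> 0 < delta < 1 -> 3 <= alpha ->
  (1 - eps) / eps <= alpha -> (1 - delta) / delta <= alpha ->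
  (forall k, 1 <= mu k) -> 0 < K -> (forall k, k.+1%:R <= K * mu k) -> 0 < CB ->
  (forall k, expR (- CB * mu k `^ (1 - delta)) <= `|beta k|) -> 0 < C1 ->
  (forall T k, 0 < T < 1 ->
    exists q : R -> R, [/\ continuous q, (forall s, q s != 0 -> 0 <= s <= T),
    (forall s, `|q s| <= C1 * expR (C1 / T ^+ 3 + C1 * mu k `^ (1 - eps) - mu k * (T / 2))) &
    forall j, exp_moment T (mu j) q = (j == k)%:R]) ->
  exists2 C, 0 < C & forall (x : nat -> R) (N T : R), (forall k, `|x k| <= N) -> 0 < T < 1 ->
    exists v : R -> R, [/\ continuous v, (forall s, v s != 0 -> 0 <= s <= T),
      (forall s, `|v s| <= C * expR (C / T `^ alpha) * N) &
      forall j, exp_moment T (mu j) v = x j / beta j].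
Proof.
move=> eps01 delta01 alpha3 alphae alphad mu1 K0 Kmu CB0 hbeta C10 bio.
have [A1 A10 hA1] := powR_absorb C10 eps01.
have [A2 A20 hA2] := powR_absorb CB0 delta01.
(* The summand 1 absorbs a factor W <= e^W, where W bounds the T^(-2) arising in [dec]. In [F], 64
   is the 32 of [dec] times the bound 2 on the sum of the inverse squares. *)
pose D := C1 + A1 + A2 + 1; have D0 : 0 < D by rewrite /D; lra.
pose F := 64 * C1 * K ^+ 2; have F0 : 0 < F by rewrite /F !mulr_gt0// exprn_gt0.
exists (F + D); first by rewrite addr_gt0.
move=> x N T xN T01; have /andP[T0 T1] := T01.
have N0 : 0 <= N by rewrite (le_trans _ (xN 0%N)).
have beta0 k : 0 < `|beta k| by rewrite (lt_le_trans _ (hbeta k))// expR_gt0.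
have mu0 k : 0 < mu k by rewrite (lt_le_trans _ (mu1 k)).
pose W := 1 / T `^ alpha.
have W0 : 0 <= W by rewrite divr_ge0// powR_ge0.
have TW r : r <= alpha -> 1 / T `^ r <= W.
  by move=> ra; rewrite /W !div1r lef_pV2 ?posrE ?powR_gt0// ger_powR// T0 ltW.
have TWn n : n%:R <= alpha -> 1 / T ^+ n <= W.
  by move=> na; rewrite -powR_mulrn ?(ltW T0)//; exact: TW.
have /choice[q hq] k := bio T k T01.
pose c k := x k / beta k.
pose bnd k := N * (F / 2 * expR (D * W)) * (k.+1%:R)^-1 ^+ 2.
have hbnd k s : `|c k * q k s| <= bnd k.
  have [_ _ qb _] := hq k.
  pose E := C1 / T ^+ 3 + C1 * mu k `^ (1 - eps) - mu k * (T / 2).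
  have c1 : `|c k| <= N * expR (CB * mu k `^ (1 - delta)).
    rewrite /c normrM normfV ler_pM ?invr_ge0//.
    by rewrite -[leRHS]invrK lef_pV2 ?posrE ?invr_gt0 ?expR_gt0// -expRN -mulNr.
  apply: (@le_trans _ _ (N * expR (CB * mu k `^ (1 - delta)) * (C1 * expR E))).
    by rewrite normrM ler_pM.
  have expo : CB * mu k `^ (1 - delta) + E <= (C1 + A1 + A2) * W - mu k * T / 4.
    have h1 := hA1 T (mu k) T0 (mu0 k); have h2 := hA2 T (mu k) T0 (mu0 k).
    have w1 : C1 * (1 / T ^+ 3) <= C1 * W by rewrite (ler_wpM2l (ltW C10))// TWn.
    have w2 : A1 * (1 / T `^ ((1 - eps) / eps)) <= A1 * W by rewrite (ler_wpM2l (ltW A10))// TW.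
    have w3 : A2 * (1 / T `^ ((1 - delta) / delta)) <= A2 * W by rewrite (ler_wpM2l (ltW A20))// TW.
    rewrite /E; move: w1 w2 w3 h1 h2; rewrite !div1r; lra.
  (* From e^(-y) <= 2 / y^2 and mu_k >= (k + 1) / K. *)
  have dec : expR (- (mu k * T / 4)) <= 32 * K ^+ 2 * W * (k.+1%:R)^-1 ^+ 2.
    have y0 : 0 < mu k * T / 4 by rewrite divr_gt0// mulr_gt0.
    apply: (@le_trans _ _ (2 / (mu k * T / 4) ^+ 2)).
      rewrite expRN -[leRHS]invrK invf_div lef_pV2 ?posrE ?expR_gt0 ?divr_gt0 ?exprn_gt0//.
      by have := expR_ge1Dxn 1 (ltW y0); rewrite -[2`!]/2%N; lra.
    have -> : 2 / (mu k * T / 4) ^+ 2 = 32 * (1 / T ^+ 2) * (mu k)^-1 ^+ 2.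
      by field; rewrite !gt_eqF.
    have -> : 32 * K ^+ 2 * W * k.+1%:R^-1 ^+ 2 = 32 * W * (K * k.+1%:R^-1) ^+ 2 by ring.
    apply: ler_pM.
    - by rewrite mulr_ge0// divr_ge0// exprn_ge0// ltW.
    - by rewrite exprn_ge0// invr_ge0 ltW.
    - by rewrite ler_wpM2l// TWn//; lra.
    rewrite lerXn2r ?nnegrE ?mulr_ge0 ?invr_ge0 ?(ltW K0) ?(ltW (mu0 _))//.
    by rewrite ler_pdivlMr// mulrC ler_pdivrMr.
  have -> : N * expR (CB * mu k `^ (1 - delta)) * (C1 * expR E) =
    N * C1 * expR (CB * mu k `^ (1 - delta) + E) by rewrite [in RHS](expRD _ E); ring.
  have -> : bnd k = N * C1 * (32 * K ^+ 2 * k.+1%:R^-1 ^+ 2 * expR (D * W)).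
    by rewrite /bnd /F; move: (k.+1%:R^-1) (expR _) => y z; field.
  rewrite ler_wpM2l ?mulr_ge0 ?(ltW C10)//.
  apply: (@le_trans _ _ (expR ((C1 + A1 + A2) * W) * expR (- (mu k * T / 4)))).
    by rewrite -expRD ler_expR.
  apply: (@le_trans _ _ (expR ((C1 + A1 + A2) * W) * (32 * K ^+ 2 * W * (k.+1%:R)^-1 ^+ 2))).
    by rewrite ler_wpM2l ?expR_ge0.
  have We : W <= expR W by rewrite (le_trans _ (expR_ge1Dx _))// lerDr.
  have -> : expR (D * W) = expR ((C1 + A1 + A2) * W) * expR W.
    by rewrite -expRD; congr expR; rewrite /D; ring.
  have -> : expR ((C1 + A1 + A2) * W) * (32 * K ^+ 2 * W * (k.+1%:R)^-1 ^+ 2) =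
    32 * K ^+ 2 * (k.+1%:R)^-1 ^+ 2 * expR ((C1 + A1 + A2) * W) * W by ring.
  by rewrite [leRHS]mulrA ler_wpM2l// !mulr_ge0 ?expR_ge0 ?exprn_ge0 ?invr_ge0 ?(ltW K0).
pose u n s := \sum_(k < n) c k * q k s.
have u0 : u 0%N = cst 0 by apply/funext => s; rewrite /u big_ord0.
have uS n : u n.+1 = (fun s => u n s + c n * q n s).
  by apply/funext => s; rewrite /u big_ord_recr.
have cu n : continuous (u n).
  elim: n => [|n IH] s.
    by rewrite u0; exact: cvg_cst.
  rewrite uS; apply: cvgD; first exact: IH.
  by apply: cvgM; [exact: cvg_cst|have [cq _ _ _] := hq n; exact: cq].
have sum_bnd n : \sum_(k < n) bnd k <= N * (F * expR (D * W)).
  rewrite -mulr_sumr (le_trans (ler_wpM2l _ (sum_inv_sqr_le n)))//.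
    by rewrite mulr_ge0// mulr_ge0 ?expR_ge0// divr_ge0// (ltW F0).
  by rewrite le_eqVlt; apply/orP; left; apply/eqP; field.
have [] := @uniform_limit_bounded_variation R u bnd (N * (F * expR (D * W))) cu.
- by move=> n s; rewrite uS addrAC subrr add0r.
- exact: sum_bnd.
move=> v [cv vu]; exists v; split => //.
- move=> s; apply: contra_neqT => sT; apply: (uniform_limit_eq0 vu) => n.
  rewrite /u big1// => k _; have [_ q0 _ _] := hq k.
  by rewrite (contraNeq (q0 s) sT) mulr0.
- move=> s; apply: (uniform_limit_le vu) => n; rewrite /u.
  apply: le_trans (ler_norm_sum _ _ _) _.
  apply: (@le_trans _ _ (\sum_(k < n) bnd k)); first by apply: ler_sum => k _.
  apply: (le_trans (sum_bnd n)); rewrite mulrC ler_wpM2r//.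
  rewrite ler_pM ?expR_ge0 ?(ltW F0)//; first by rewrite lerDl ltW.
  by rewrite ler_expR /W mulrA mulr1 ler_wpM2r ?invr_ge0 ?powR_ge0// lerDr ltW.
- move=> j; have := exp_moment_cvg vu T0 (ltW (mu0 j)) cu cv.
  (* By biorthogonality the partial sums all have the same j-th moment once the term of index j is
     included. *)
  move=> /(@cvg_lim _ _)<-//; apply: lim_near_cst => //.
  exists j.+1 => // n /= jn.
  have Eu m : exp_moment T (mu j) (u m) = \sum_(k < m) c k * (j == k)%:R.
    elim: m => [|m IH].
      rewrite big_ord0 /exp_moment; rewrite u0; under eq_Rintegral do rewrite mul0r.
      by rewrite Rintegral_cst// mul0r.
    rewrite big_ord_recr/= -IH; have [cq _ _ qm] := hq m.
    have -> : u m.+1 = (fun s => u m s - (- c m) * q m s).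
      by rewrite uS; apply/funext => s; rewrite mulNr opprK.
    by rewrite exp_momentBZ// qm mulNr opprK.
  rewrite Eu (bigD1 (Ordinal jn))//= eqxx mulr1 big1 ?addr0// => i ij.
  by rewrite (_ : j == i = false) ?mulr0//; apply: contraNF ij => /eqP ji; apply/eqP/val_inj.
Qed.

End control.

(** * Diagonal operators on a Hilbert space *)

Section hilbert.
Context (R : realType) (H : completeNormedModType R) (ip : {dot H for idfun}).
Hypothesis H_hilbert : norm_of_dot ip.
Implicit Types x y h : H.

Lemma dot_sym x y : ip x y = ip y x.
Proof. by rewrite hermC/= expr0 mul1r. Qed.

Lemma dotBl x y h : ip (x - y) h = ip x h - ip y h. Proof. exact: linearBl. Qed.
Lemma dotZl (c : R) x h : ip (c *: x) h = c * ip x h. Proof. exact: linearZl_LR. Qed.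
Lemma dot0l h : ip 0 h = 0. Proof. exact: linear0l. Qed.

Lemma dot_suml I (r : seq I) (P : pred I) (E : I -> H) h :
  ip (\sum_(i <- r | P i) E i) h = \sum_(i <- r | P i) ip (E i) h.
Proof. exact: (linear_sumlz ip). Qed.

Lemma cauchy_schwarz x y : `|ip x y| <= `|x| * `|y|.
Proof.
have [->|y0] := eqVneq y 0; first by rewrite dot_sym dot0l !normr0 mulr0.
have ny : 0 < `|y| by rewrite normr_gt0.
rewrite -(@ler_pXn2r _ 2) ?nnegrE ?mulr_ge0// real_normK ?num_real// exprMn.
pose c := ip x y / `|y| ^+ 2.
have : 0 <= ip (x - c *: y) (x - c *: y) by rewrite H_hilbert sqr_ge0.
rewrite dotBl dotZl [ip x _]dot_sym [ip y (_ - _)]dot_sym !dotBl !dotZl !H_hilbert.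
rewrite [ip y x]dot_sym.
have -> : c * `|y| ^+ 2 = ip x y by rewrite /c divfK// gt_eqF// exprn_gt0.
rewrite subrr mulr0 subr0 /c mulrAC subr_ge0 ler_pdivrMr ?exprn_gt0//.
Qed.

Lemma dot_cvg {T : Type} {G : set_system T} {FG : Filter G} (u : T -> H) x h :
  u @ G --> x -> ip (u n) h @[n --> G] --> ip x h.
Proof.
move=> ux; apply/cvgrPdist_le => e e0.
have h0 : 0 < `|h| + 1 by rewrite ltr_wpDl.
have eh : 0 < e / (`|h| + 1) by rewrite divr_gt0.
have /cvgrPdist_le/(_ _ eh) := ux; apply: filterS => n xn.
rewrite -dotBl (le_trans (cauchy_schwarz _ _))//.
rewrite (le_trans (ler_wpM2r (normr_ge0 _) xn))// mulrAC ler_pdivrMr//.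
by rewrite ler_wpM2l ?(ltW e0)// lerDl.
Qed.

Section orthonormal.
Variable phi : nat -> H.
Hypothesis phi_on : orthonormal_seq ip phi.

Lemma orthonormal_norm k : `|phi k| = 1.
Proof.
by apply/eqP; rewrite -(@eqrXn2 _ 2)// expr1n -H_hilbert phi_on eqxx.
Qed.

Lemma dot_sum_phi (c : nat -> R) (r : seq nat) k : uniq r ->
  ip (\sum_(i <- r) c i *: phi i) (phi k) = if k \in r then c k else 0.
Proof.
move=> ur; rewrite dot_suml; under eq_bigr do rewrite dotZl phi_on.
case: ifP => kr; last first.
  rewrite big_seq big1// => i ir; case: eqVneq => [ik|]; last by rewrite mulr0.
  by rewrite -ik ir in kr.
rewrite (bigD1_seq k)//= eqxx mulr1 big1 ?addr0// => i /negPf->.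
by rewrite mulr0.
Qed.

Lemma norm_sum_phi (c : nat -> R) (r : seq nat) : uniq r ->
  `|\sum_(i <- r) c i *: phi i| ^+ 2 = \sum_(i <- r) c i ^+ 2.
Proof.
move=> ur; rewrite -H_hilbert dot_suml big_seq [RHS]big_seq; apply: eq_bigr => i ir.
by rewrite dotZl dot_sym dot_sum_phi// ir expr2.
Qed.

Lemma bessel x n : \sum_(0 <= k < n) ip x (phi k) ^+ 2 <= `|x| ^+ 2.
Proof.
pose y := \sum_(0 <= k < n) ip x (phi k) *: phi k.
have yE : ip x y = \sum_(0 <= k < n) ip x (phi k) ^+ 2.
  rewrite dot_sym dot_suml; apply: eq_bigr => k _.
  by rewrite dotZl dot_sym expr2.
have := sqr_ge0 `|x - y|; rewrite -(H_hilbert (x - y)) dotBl.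
rewrite [ip x (_ - _)]dot_sym [ip y (_ - _)]dot_sym !dotBl !H_hilbert [ip y x]dot_sym yE.
by rewrite norm_sum_phi ?iota_uniq//; lra.
Qed.

Lemma cvg_diag_series (c : nat -> R) (M : R) x : (forall k, `|c k| <= M) ->
  cvgn (series (fun k => (c k * ip x (phi k)) *: phi k)).
Proof.
move=> cM; have M0 : 0 <= M by exact: le_trans (cM 0%N).
pose b := series (fun k => (ip x (phi k)) ^+ 2).
have ndb : nondecreasing_seq b by apply: nondecreasing_series => *; exact: sqr_ge0.
have cb : cvgn b.
  by apply: nondecreasing_is_cvgn => //; exists (`|x| ^+ 2) => _ [n _ <-]; exact: bessel.
apply: norm_cauchy_cvgn => e e0.
(* M + 1 rather than M, since M may be 0. *)
have M1 : 0 < (M + 1) ^+ 2 by rewrite exprn_gt0// ltr_wpDl.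
have eM : 0 < e ^+ 2 / (M + 1) ^+ 2 by rewrite divr_gt0// exprn_gt0.
have /cvgrPdist_le/(_ _ eM)[N _ Nb] := cb.
exists N => n Nn; rewrite sub_series_geq//.
rewrite -(@ler_pXn2r _ 2) ?nnegrE ?(ltW e0)// norm_sum_phi ?iota_uniq//.
apply: (@le_trans _ _ (\sum_(N <= k < n) (M ^+ 2 * ip x (phi k) ^+ 2))).
  apply: ler_sum => k _; rewrite exprMn ler_wpM2r ?sqr_ge0//.
  by rewrite -real_normK ?num_real// lerXn2r ?nnegrE.
rewrite -mulr_sumr -/(series _) -sub_series_geq// -/b.
have bN : b n - b N <= e ^+ 2 / (M + 1) ^+ 2.
  have /= bNl := Nb N (leqnn N); apply: (le_trans _ bNl).
  by rewrite (le_trans _ (ler_norm _))// lerB// nondecreasing_cvgn_le.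
have b0 : 0 <= b n - b N by rewrite subr_ge0 ndb.
move: bN; rewrite ler_pdivlMr// => bN; rewrite (le_trans _ bN)// mulrC.
rewrite ler_wpM2l// lerXn2r ?nnegrE ?addr_ge0//.
by rewrite lerDl.
Qed.

Lemma dot_diag_op (c : nat -> R) (M : R) x k : (forall k, `|c k| <= M) ->
  ip (diag_op ip phi c x) (phi k) = c k * ip x (phi k).
Proof.
move=> cM; have /(dot_cvg (h := phi k)) := @cvg_diag_series c M x cM.
move=> /(@cvg_lim _ _)<-//; apply: lim_near_cst => //.
exists k.+1 => // n /= kn.
by rewrite /series/= dot_sum_phi ?iota_uniq// mem_index_iota/= kn.
Qed.

Lemma norm_diag_op_le (c : nat -> R) (M A : R) x : 0 <= A -> (forall k, `|c k| <= M) ->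
  (forall n, \sum_(0 <= k < n) (c k * ip x (phi k)) ^+ 2 <= A ^+ 2) ->
  `|diag_op ip phi c x| <= A.
Proof.
move=> A0 cM cA; have /cvg_norm cn := @cvg_diag_series c M x cM.
rewrite /diag_op -(cvg_lim _ cn)//; apply: limr_le.
  by apply/cvg_ex; exists `|diag_op ip phi c x|.
exists 0%N => // n _ /=.
by rewrite -(@ler_pXn2r _ 2) ?nnegrE// norm_sum_phi ?iota_uniq.
Qed.

Lemma diag_opB (c d : nat -> R) (M : R) x : (forall k, `|c k| <= M) ->
  (forall k, `|d k| <= M) ->
  diag_op ip phi c x - diag_op ip phi d x = diag_op ip phi (fun k => c k - d k) x.
Proof.
move=> cM dM; have cc := @cvg_diag_series c M x cM.
have cd := @cvg_diag_series d M x dM.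
rewrite /diag_op -(limB cc cd); set u := (_ - _); set w := series _.
suff -> : u = w by [].
apply/funext => n; rewrite /u /w /series/= !fctE -sumrB.
by apply: eq_bigr => k _; rewrite mulrBl scalerBl.
Qed.

End orthonormal.

(** The difference z is orthogonal to every finite combination w; choosing w within e of z by
    density, |z|^2 = ip (z - w) z <= e |z|. *)
Lemma dot_basis_inj phi x y : hilbert_basis ip phi ->
  (forall k, ip x (phi k) = ip y (phi k)) -> x = y.
Proof.
move=> [phi_on phi_dense] xy; apply/eqP; rewrite -subr_eq0; apply/eqP.
set z := x - y; have z0 k : ip z (phi k) = 0 by rewrite dotBl xy subrr.
apply/eqP; rewrite -normr_eq0; apply/eqP/le_anti; rewrite normr_ge0 andbT.
apply/ler_addgt0Pl => e e0; rewrite addr0.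
have [w [zw [n [c wE]]]] : ball z e `&`
    [set x | exists n (c : nat -> R), x = \sum_(k < n) c k *: phi k] !=set0.
  by apply: phi_dense; [exists z; exact: ballxx|exact: ball_open].
have zw0 : ip z w = 0.
  by rewrite dot_sym wE dot_suml big1// => i _; rewrite dotZl dot_sym z0 mulr0.
have : `|z| ^+ 2 <= `|z - w| * `|z|.
  rewrite (le_trans _ (cauchy_schwarz _ _))// (le_trans _ (ler_norm _))//.
  by rewrite dotBl [ip w z]dot_sym zw0 subr0 H_hilbert.
move: zw; rewrite -ball_normE/= => zw.
have [->|zn] := eqVneq z 0; first by move=> _; rewrite normr0 ltW.
by rewrite expr2 ler_pM2r ?normr_gt0// => /le_trans; apply; exact: ltW.
Qed.

End hilbert.

(** * Strong continuity of the diagonal semigroup *)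

Section semigroup.
Context (R : realType) (H : completeNormedModType R) (ip : {dot H for idfun}).
Hypothesis H_hilbert : norm_of_dot ip.
Context (phi : nat -> H) (mu : nat -> R).
Hypothesis phi_on : orthonormal_seq ip phi.
Hypothesis mu0 : forall k, 0 <= mu k.
Hypothesis mu_nd : nondecreasing_seq mu.

Lemma semigroup_coef_le1 t k : 0 <= t -> `|expR (- mu k * t)| <= 1.
Proof.
by move=> t0; rewrite ger0_norm ?expR_ge0// -[leRHS]expR0 ler_expR mulNr oppr_le0 mulr_ge0.
Qed.

Lemma dot_semigroup t x k : 0 <= t ->
  ip (diag_semigroup ip phi mu t x) (phi k) = expR (- mu k * t) * ip x (phi k).
Proof.
by move=> t0; rewrite (dot_diag_op H_hilbert phi_on (M := 1))// => i; exact: semigroup_coef_le1.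
Qed.

Lemma expRN_lipschitz (r1 r2 : R) : 0 <= r1 -> 0 <= r2 ->
  `|expR (- r1) - expR (- r2)| <= `|r1 - r2|.
Proof.
wlog r12 : r1 r2 / r1 <= r2 => [hw r10 r20|r10 r20].
  by case/orP: (le_total r1 r2) => ?; [|rewrite distrC [leRHS]distrC]; exact: hw.
rewrite ger0_norm; last by rewrite subr_ge0 ler_expR lerN2.
rewrite distrC ger0_norm ?subr_ge0//.
have -> : - r2 = - r1 + - (r2 - r1) by ring.
rewrite expRD; have e1 : expR (- r1) <= 1 by rewrite -[leRHS]expR0 ler_expR oppr_le0.
have e2 := expR_ge1Dx (- (r2 - r1)).
have e3 : expR (- (r2 - r1)) <= 1 by rewrite -[leRHS]expR0 ler_expR oppr_le0 subr_ge0.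
apply: (@le_trans _ _ (1 * (1 - expR (- (r2 - r1))))); last by lra.
by rewrite -[X in X - _]mulr1 -mulrBr ler_wpM2r// subr_ge0.
Qed.

(** Modes below N are Lipschitz in time with constant mu_N; the others have coefficients differing
    by at most 1 and are controlled by the tail of the Bessel series. *)
Lemma semigroup_equicontinuous x e : 0 < e -> exists2 d : R, 0 < d &
  forall r1 r2, 0 <= r1 -> 0 <= r2 -> `|r1 - r2| <= d ->
  `|diag_semigroup ip phi mu r1 x - diag_semigroup ip phi mu r2 x| <= e.
Proof.
move=> e0; pose b := series (fun k => ip x (phi k) ^+ 2).
have ndb : nondecreasing_seq b by apply: nondecreasing_series => *; exact: sqr_ge0.
have cb : cvgn b.
  apply: nondecreasing_is_cvgn => //; exists (`|x| ^+ 2) => _ [n _ <-].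
  exact: bessel.
have e20 : 0 < e ^+ 2 / 2 by rewrite divr_gt0// exprn_gt0.
have /cvgrPdist_le/(_ _ e20)[N _ Nb] := cb.
pose d := e / (2 * (mu N + 1) * (`|x| + 1)).
have muN1 : 0 < mu N + 1 by rewrite ltr_wpDl.
have x1 : 0 < `|x| + 1 by rewrite ltr_wpDl.
have d0 : 0 < d by rewrite divr_gt0// !mulr_gt0.
have mud0 : 0 <= mu N * d := mulr_ge0 (mu0 N) (ltW d0).
have mudx0 : 0 <= mu N * d * `|x| := mulr_ge0 mud0 (normr_ge0 x).
exists d => // r1 r2 r10 r20 rd.
have cM t : 0 <= t -> forall k, `|expR (- mu k * t)| <= 1 by move=> ? k; exact: semigroup_coef_le1.
rewrite /diag_semigroup (diag_opB H_hilbert phi_on x (cM _ r10) (cM _ r20)).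
pose c k := expR (- mu k * r1) - expR (- mu k * r2).
have c1 k : `|c k| <= 1.
  have := expR_gt0 (- mu k * r1); have := expR_gt0 (- mu k * r2).
  have := le_trans (ler_norm _) (cM _ r10 k).
  have := le_trans (ler_norm _) (cM _ r20 k) => *.
  by rewrite /c ler_norml; apply/andP; split; lra.
apply: (@norm_diag_op_le _ _ _ H_hilbert phi phi_on c 1); [exact: ltW|exact: c1|] => n.
(* Lengthening the sum from n to n + N terms allows splitting at N without comparing n with N. *)
have step m : \sum_(0 <= k < n) (c k * ip x (phi k)) ^+ 2 <=
    \sum_(0 <= k < n + m) (c k * ip x (phi k)) ^+ 2.
  rewrite [leRHS](@big_cat_nat _ _ _ n)//= ?leq_addr// lerDl sumr_ge0// => *.
  exact: sqr_ge0.
apply: (le_trans (step N)).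
rewrite (@big_cat_nat _ _ _ N)//= ?leq_addl//.
have -> : e ^+ 2 = e ^+ 2 / 2 + e ^+ 2 / 2 by field.
apply: lerD.
  apply: (@le_trans _ _ (\sum_(0 <= k < N) ((mu N * d) ^+ 2 * ip x (phi k) ^+ 2))).
    rewrite big_nat [leRHS]big_nat; apply: ler_sum => k /= kN.
    rewrite exprMn ler_wpM2r ?sqr_ge0// -real_normK ?num_real//.
    rewrite lerXn2r ?nnegrE//.
    rewrite /c !mulNr (le_trans (expRN_lipschitz _ _)) ?mulr_ge0//.
    rewrite -mulrBr normrM (ger0_norm (mu0 _)) ler_pM//.
    by rewrite mu_nd// ltnW.
  rewrite -mulr_sumr (le_trans (ler_wpM2l _ (bessel H_hilbert phi_on x N))) ?sqr_ge0//.
  rewrite -exprMn; apply: (@le_trans _ _ ((e / 2) ^+ 2)).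
    rewrite lerXn2r ?nnegrE// ?divr_ge0 ?(ltW e0)//.
    have -> : e / 2 = (mu N + 1) * d * (`|x| + 1) by rewrite /d; field; rewrite !gt_eqF.
    rewrite ler_pM ?lerDl//.
    by rewrite ler_wpM2r ?(ltW d0)// lerDl.
  by rewrite expr_div_n; have := sqr_ge0 e; lra.
apply: (@le_trans _ _ (\sum_(N <= k < n + N) ip x (phi k) ^+ 2)).
  apply: ler_sum => k _; rewrite exprMn ler_piMl ?sqr_ge0//.
  by rewrite -real_normK ?num_real// exprn_ile1.
rewrite -/(series _) -sub_series_geq ?leq_addl// -/b.
have /= bNl := Nb N (leqnn N); apply: (le_trans _ bNl).
by rewrite (le_trans _ (ler_norm _))// lerB// nondecreasing_cvgn_le.
Qed.

(** Truncating t - s at 0 extends the integrand continuously to the whole line: for negative times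
    the coefficients of the semigroup may be unbounded. *)
Lemma continuous_semigroup_arg (v : R -> R) (t : R) x : continuous v ->
  continuous (fun s => v s *: diag_semigroup ip phi mu (Num.max (t - s) 0) x).
Proof.
move=> cv s; apply: cvgZ; first exact: cv.
apply/cvgrPdist_le => e e0; have [d d0 hd] := semigroup_equicontinuous x e0.
have /cvgrPdist_le/(_ _ d0) := @cvg_id _ (nbhs s).
apply: filterS => y sy; apply: hd; rewrite ?le_max ?lexx ?orbT//.
apply: (le_trans _ sy); rewrite [leRHS]distrC.
have -> : y - s = (t - s) - (t - y) by ring.
move: (t - s) (t - y) => p q.
case: (leP p 0) => hp; case: (leP q 0) => hq //.
- by rewrite subrr normr0.
- by rewrite sub0r normrN gtr0_norm// distrC (le_trans _ (ler_norm _))//; lra.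
- by rewrite subr0 gtr0_norm// (le_trans _ (ler_norm _))//; lra.
Qed.

End semigroup.

(** * Bochner integrals of continuous functions *)

Section simple_functions.
Context d (X : measurableType d) (R : realType) (H : completeNormedModType R).
Variables (m : {measure set X -> \bar R}) (D : set X).
Hypotheses (mD : measurable D) (Doo : (m D < +oo)%E).
Variable g : {fimfun X >-> H}.
Hypothesis gint : integrable_simple m D g.

(** [integrable_simple] says nothing of the value 0; its fibre is what the finitely many other
    fibres leave in D. *)
Lemma measurable_simple_preimage h : measurable (D `&` g @^-1` [set h]).
Proof.
have [->|h0] := eqVneq h 0; last by have [] := gint h0.
rewrite (_ : _ `&` _ = D `\` \bigcup_(h' in range g `&` [set~ 0]) (D `&` g @^-1` [set h'])).
  apply: measurableD => //; apply: fin_bigcup_measurable.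
    exact: finite_setIl.
  by move=> h' [_ /= /eqP h'0]; have [] := gint h'0.
apply/seteqP; split => [x [Dx /= gx]|x [Dx nx]].
  by split => // -[h' [_ /= h'0] [_ /= gh']]; apply: h'0; rewrite -gh'.
split => //=; apply: contrapT => gx; apply: nx; by exists (g x).
Qed.

(** No sigma-algebra is put on H: measurability is checked on each of the finitely many fibres of
    [g]. *)
Lemma measurable_simple_comp d' (Y : measurableType d') (G : H -> X -> Y) :
  (forall h, measurable_fun D (G h)) -> measurable_fun D (fun x => G (g x) x).
Proof.
move=> mG _ B mB.
rewrite (_ : _ `&` _ = \bigcup_(h in range g)
    ((D `&` g @^-1` [set h]) `&` (D `&` G h @^-1` B))).
  apply: fin_bigcup_measurable => // h _.
  by apply: measurableI; [exact: measurable_simple_preimage|exact: mG].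
apply/seteqP; split => [x [Dx /= Bx]|x [h _ [[Dx /= gx] [_ /= Bx]]]].
  by exists (g x) => //; exists x.
by split => //=; rewrite gx.
Qed.

Lemma bounded_integrable (f : X -> R) (M : R) : measurable_fun D f ->
  (forall x, D x -> `|f x| <= M) -> m.-integrable D (EFin \o f).
Proof.
move=> mf fM; apply: measurable_bounded_integrable => //.
exists M; split; first exact: num_real.
by move=> r Mr x Dx; apply: (le_trans (fM _ Dx)); exact: ltW.
Qed.

Variable ip : {dot H for idfun}.

(** Reduces vector-valued integrals to scalar ones, by decomposing [g] into the indicators of its
    fibres. *)
Lemma dot_simple_integral h :
  ip (simple_integral m D g) h = \int[m]_(x in D) ip (g x) h.
Proof.
pose f h' x : R := if g x == h' then ip h' h else 0.
have mf h' : measurable_fun D (f h').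
  by apply: (@measurable_simple_comp _ _ (fun h'' _ => if h'' == h' then ip h' h else 0)).
have fint h' : m.-integrable D (EFin \o f h').
  apply: (@bounded_integrable _ `|ip h' h|) => // x _; rewrite /f.
  by case: ifP; rewrite ?normr0.
have fE h' : \int[m]_(x in D) f h' x = fine (m (D `&` g @^-1` [set h'])) * ip h' h.
  rewrite mulrC -Rintegral_cst; last exact: measurable_simple_preimage.
  rewrite Rintegral_mkcondr; apply: eq_Rintegral => x _; rewrite /f /patch.
  case: ifPn => [/eqP gx|/eqP gx]; first by rewrite mem_set.
  by rewrite memNset.
rewrite /simple_integral fsbig_finite//= dot_suml.
under eq_bigr do rewrite dotZl -fE.
set r := (X in \sum_(i <- X) _).
have -> : \int[m]_(x in D) ip (g x) h = \int[m]_(x in D) \sum_(h' <- r) f h' x.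
  apply: eq_Rintegral => x _; rewrite (bigD1_seq (g x))//=.
  - by rewrite /f eqxx big1 ?addr0// => h' /negPf; rewrite eq_sym => ->.
  - by rewrite in_fset_set//; apply/mem_set; exists x.
  - exact: finmap.fset_uniq.
elim: r => [|h' r IH].
  rewrite big_nil; under eq_Rintegral do rewrite big_nil.
  by rewrite Rintegral_cst// mul0r.
rewrite big_cons IH -RintegralD//.
  by apply: eq_Rintegral => x _; rewrite big_cons.
elim: r {IH} => [|h2 r IH].
  rewrite (_ : _ \o _ = EFin \o cst 0); last by apply/funext => x /=; rewrite big_nil.
  by apply: (@bounded_integrable _ 0) => // x _; rewrite normr0.
rewrite (_ : _ \o _ = ((EFin \o f h2) \+ (EFin \o (fun x => \sum_(i <- r) f i x)%R))%E).
  exact: integrableD.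
by apply/funext => x /=; rewrite big_cons EFinD.
Qed.

End simple_functions.

Section heine.
Context (R : realType) (V : normedModType R).

(** Heine-Cantor, with only [x] confined to the segment. Compactness is used as near-covering, for
    the filter of radii tending to 0 from the right. *)
Lemma continuous_uniform_segment (F : R -> V) (t : R) e : continuous F -> 0 < e ->
  exists2 r : R, 0 < r & forall x y, 0 <= x <= t -> `|x - y| <= r -> `|F x - F y| <= e.
Proof.
move=> cF e0; have /compact_near_coveringP := @segment_compact R 0 t.
have e20 : 0 < e / 2 by rewrite divr_gt0.
move=> /(_ R 0^'+ (fun r x => forall y, `|x - y| <= r -> `|F x - F y| <= e)).
move=> /(_ _)[x _|r /= r0 hr].
  have /cvgrPdist_le/(_ _ e20)/nbhs_ballP[r /= r0 hr] := cF x.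
  exists (ball x (r / 2), [set s | s < r / 2]) => /=.
    split; first by apply: nbhsx_ballx; rewrite divr_gt0.
    by exists (r / 2) => /=; [rewrite divr_gt0|move=> s /= + s0; rewrite sub0r normrN gtr0_norm].
  move=> [x' s] /= [xx' sr] y x'y.
  have h1 : ball x r x'.
    by apply: le_ball xx'; rewrite ler_pdivrMr// ler_peMr ?(ltW r0)// ler1n.
  have h2 : ball x r y.
    move: xx'; rewrite -!ball_normE/= => xx'.
    rewrite (_ : x - y = (x - x') + (x' - y)); last by ring.
    rewrite (le_lt_trans (ler_normD _ _))// (_ : r = r / 2 + r / 2); last by field.
    by rewrite ltr_leD// (le_trans x'y)// ltW.
  rewrite (_ : F x' - F y = (F x - F y) - (F x - F x')); last first.
    by rewrite opprB [RHS]addrC addrA subrK.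
  rewrite (le_trans (ler_normB _ _))// (_ : e = e / 2 + e / 2); last by field.
  by rewrite lerD// hr.
exists (r / 2); first by rewrite divr_gt0.
move=> x y xt xy; apply: (hr (r / 2)) => //=.
- rewrite sub0r normrN gtr0_norm ?divr_gt0// ltr_pdivrMr// ltr_pMr// ltr1n//.
- by rewrite divr_gt0.
Qed.

End heine.

Section bochner_continuous.
Context (R : realType) (H : completeNormedModType R) (ip : {dot H for idfun}).
Hypothesis H_hilbert : norm_of_dot ip.
Variables (F : R -> H) (t : R).
Hypothesis cF : continuous F.
Let leb : {measure set (measurableTypeR R) -> \bar R} := @lebesgue_measure R.
Let D : set (measurableTypeR R) := `]0, t[%classic.

Let mD : measurable D. Proof. exact: measurable_itv. Qed.

Let leb_D : leb D = (Num.max 0 t)%:E.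
Proof.
rewrite -[LHS]/(@lebesgue_measure R `]0, t[%classic) (@lebesgue_measure_itv R `]0, t[%R)/= lte_fin.
by case: ltP => t0; rewrite ?oppr0 ?adde0.
Qed.

Let Doo : (leb D < +oo)%E. Proof. by rewrite leb_D ltry. Qed.

Let continuous_dot h : continuous (fun s => ip (F s) h).
Proof. by move=> s; apply: dot_cvg => //; exact: cF. Qed.

Let integrable_dot h : leb.-integrable D (EFin \o (fun s => ip (F s) h)).
Proof.
have ci := @continuous_integrable_itv R (fun s => ip (F s) h) 0 t (@continuous_dot h).
apply: (integrableS _ _ _ ci) => //.
by move=> x /=; rewrite /D/= !in_itv/= => /andP[/ltW-> /ltW->].
Qed.

Let measurable_dist (g : {fimfun (measurableTypeR R) >-> H}) : integrable_simple leb D g ->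
  measurable_fun D (fun s => `|F s - g s|).
Proof.
move=> gint.
apply: (measurable_simple_comp mD gint (G := fun h s => `|F s - h|)) => h.
apply: measurable_funTS; apply: continuous_measurable_fun => s.
apply: cvg_norm; apply: cvgB; [exact: cF|exact: cvg_cst].
Qed.

Let fimfun_bounded (g : {fimfun (measurableTypeR R) >-> H}) :
  exists M : R, forall s, `|g s| <= M.
Proof.
exists (\sum_(h <- finmap.enum_fset (fset_set (range g))) `|h|) => s.
rewrite (bigD1_seq (g s))/= ?finmap.fset_uniq//.
  by rewrite lerDl sumr_ge0.
by rewrite in_fset_set//; apply/mem_set; exists s.
Qed.

Let integrable_dot_simple (g : {fimfun (measurableTypeR R) >-> H}) h :
  integrable_simple leb D g -> leb.-integrable D (EFin \o (fun s => ip (g s) h)).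
Proof.
move=> gint; have [M gM] := fimfun_bounded g.
apply: (@bounded_integrable _ _ _ leb D mD Doo _ (M * `|h|)).
  by apply: (measurable_simple_comp mD gint (G := fun h' _ => ip h' h)).
move=> s _; rewrite (le_trans (cauchy_schwarz H_hilbert _ _))//.
by rewrite ler_wpM2r.
Qed.

(* The restriction |h| <= 1 makes |F - g n| itself dominate the integrands. *)
Lemma dot_bochner_integral h y : `|h| <= 1 ->
  is_bochner_integral leb D F y -> ip y h = \int[leb]_(s in D) ip (F s) h.
Proof.
move=> h1 [g [gint gae gF gy]].
have c1 : ip (simple_integral leb D (g n)) h @[n --> \oo] --> ip y h.
  exact: dot_cvg gy.
suff c2 : ip (simple_integral leb D (g n)) h @[n --> \oo] --> \int[leb]_(s in D) ip (F s) h.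
  by rewrite -(cvg_lim _ c1)// -(cvg_lim _ c2).
move/fine_cvgP : gF => [gfin gF].
apply/cvgrPdist_le => e e0; near=> n.
have fin_n : (\int[leb]_(x in D) `|F x - g n x|%:E)%E \is a fin_num by near: n; exact: gfin.
rewrite (dot_simple_integral mD Doo (gint n)) -RintegralB//; last exact: integrable_dot_simple.
have ie : leb.-integrable D (EFin \o (fun s => ip (F s) h - ip (g n s) h)).
  exact: (integrableB mD (integrable_dot h) (integrable_dot_simple h (gint n))).
rewrite (le_trans (le_normr_Rintegral mD ie))//.
apply: (@le_trans _ _ (fine (\int[leb]_(x in D) `|F x - g n x|%:E)%E)).
  rewrite fine_le//.
    by apply: integrable_fin_num => //; exact: integrable_norm.
  apply: ge0_le_integral => //.
  - apply/measurable_EFinP; apply: (@measurableT_comp _ _ _ _ _ _ (@Num.norm R R)) => //.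
    by apply/measurable_EFinP; exact: (measurable_int leb).
  - by apply/measurable_EFinP; exact: measurable_dist.
  - move=> x _; rewrite lee_fin -dotBl (le_trans (cauchy_schwarz H_hilbert _ _))//.
    by rewrite ler_piMr.
near: n; move/cvgrPdist_le: gF => /(_ _ e0); apply: filterS => k /=.
by rewrite sub0r normrN => /(le_trans (ler_norm _)).
Unshelve. all: end_near. Qed.

(** Sampling at the left endpoints of n + 1 equal cells; [step] is set to 0 off the interval so that
    its range is finite. *)
Let node n (i : nat) : R := i%:R * (t / n.+1%:R).
Let cell n (s : R) : nat := Num.truncn (s / (t / n.+1%:R)).
Let step n (s : measurableTypeR R) : H := if 0 < s < t then F (node n (cell n s)) else 0.

Let cellP n s : 0 < s < t -> [/\ (cell n s <= n)%N, node n (cell n s) <= s &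
  s < node n (cell n s) + t / n.+1%:R].
Proof.
move=> /andP[s0 st]; have t0 : 0 < t := lt_trans s0 st.
have n0 : 0 < n.+1%:R :> R by rewrite ltr0n.
have tn0 : 0 < t / n.+1%:R by rewrite divr_gt0.
have := @truncn_itv R (s / (t / n.+1%:R)) (divr_ge0 (ltW s0) (ltW tn0)).
rewrite -/(cell n s) ler_pdivlMr// ltr_pdivrMr// -/(node n (cell n s)) => /andP[h1 h2].
split => //; last by move: h2; rewrite /node -natr1 mulrDl mul1r.
rewrite -ltnS -(ltr_nat R); move: h1; rewrite /node => h1.
have := le_lt_trans h1 st; rewrite mulrA ltr_pdivrMr// mulrC ltr_pM2l//.
Qed.

Let finite_step n : finite_set (range (step n)).
Proof.
apply: (@sub_finite_set _ _ ([set 0] `|` (fun i => F (node n i)) @` `I_n.+1)); last first.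
  by rewrite finite_setU; split; [exact: finite_set1|exact/finite_image/finite_II].
move=> _ [s _ <-]; rewrite /step; case: ifP => [/(cellP n)[sn _ _]|_]; last by left.
by right; exists (cell n s).
Qed.

HB.instance Definition _ n := @FiniteImage.Build _ _ (step n) (finite_step n).

Let simple_step n : {fimfun (measurableTypeR R) >-> H} := step n.

Let integrable_simple_step n : integrable_simple leb D (simple_step n).
Proof.
move=> h h0; suff mA : measurable (D `&` simple_step n @^-1` [set h]).
  split=> //; apply: (le_lt_trans _ Doo); apply: le_measure; rewrite ?inE//.
rewrite (_ : _ `&` _ = \bigcup_(i in [set i | (i <= n)%N /\ F (node n i) = h])
    (D `&` [set` `[node n i, node n i + t / n.+1%:R[%R])).
  apply: fin_bigcup_measurable.
    by apply: (@sub_finite_set _ _ `I_n.+1); [move=> i [? _]|exact: finite_II].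
  by move=> i _; apply: measurableI => //; exact: measurable_itv.
apply/seteqP; split => [s [Ds]|s [i [ni Fi] [Ds /=]]].
  have st : 0 < s < t by move: Ds; rewrite /D/= in_itv.
  rewrite /= /step st => Fh; have [h1 h2 h3] := cellP n st.
  by exists (cell n s) => //; split => //=; rewrite in_itv/= h2 h3.
have st : 0 < s < t by move: Ds; rewrite /D/= in_itv.
rewrite in_itv/= => /andP[h1 h2]; split => //=; rewrite /step st.
have t0 : 0 < t by case/andP: st; exact: lt_trans.
have tn0 : 0 < t / n.+1%:R by rewrite divr_gt0.
suff -> : cell n s = i by [].
apply/eqP; rewrite /cell truncn_eq; last by rewrite divr_ge0 ?ltW//; case/andP: st.
rewrite ler_pdivlMr// ltr_pdivrMr// -/(node n i) h1/= -natr1 mulrDl mul1r.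
exact: h2.
Qed.

Let step_close e : 0 < e -> exists N, forall n, (N <= n)%N -> forall s, D s ->
  `|F s - simple_step n s| <= e.
Proof.
move=> e0; have [r r0 hr] := @continuous_uniform_segment R H F t e cF e0.
have [N hN] : exists N : nat, t / r <= N%:R.
  exists (Num.truncn (t / r)).+1.
  have [tr|tr] := leP 0 (t / r); last by rewrite (le_trans (ltW tr)).
  by have /andP[_ /ltW] := truncn_itv tr.
exists N => n Nn s Ds; have st : 0 < s < t by move: Ds; rewrite /D/= in_itv.
rewrite /= /step st; have [h1 h2 h3] := cellP n st.
have /andP[s0 s1] := st.
apply: hr; first by rewrite (ltW s0) (ltW s1).
rewrite ger0_norm ?subr_ge0//; apply: (@le_trans _ _ (t / n.+1%:R)); first by rewrite lerBlDl ltW.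
rewrite ler_pdivrMr// mulrC -ler_pdivrMr// (le_trans hN)// ler_nat.
exact: leqW.
Qed.

(** The integrals of the step functions are Cauchy: testing the difference z of two of them against
    z itself gives |z|^2 <= e |z| through scalar integrals, without a common refinement of the step
    functions. *)
Lemma bochner_integral_exists : exists y, is_bochner_integral leb D F y.
Proof.
pose I n := simple_integral leb D (simple_step n).
pose L := Num.max 0 t.
have L0 : 0 <= L by rewrite le_max lexx.
have cI : cvgn I.
  apply: norm_cauchy_cvgn => e e0.
  (* The 2 accounts for the two step functions compared, and L + 1 avoids dividing by a length L =
     0. *)
  have e2 : 0 < e / (2 * (L + 1)) by rewrite divr_gt0// mulr_gt0// ltr_wpDl.
  have [N hN] := step_close e2; exists N => n Nn.
  set z := I n - I N.
  have zz : `|z| ^+ 2 <= e * `|z|.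
    have zE : ip z z = ip (I n) z - ip (I N) z by rewrite -dotBl.
    rewrite -H_hilbert zE !(dot_simple_integral mD Doo (integrable_simple_step _)).
    rewrite -RintegralB//; try exact: integrable_dot_simple.
    have istep k := integrable_dot_simple z (integrable_simple_step k).
    have ie : leb.-integrable D
        (EFin \o (fun s => ip (simple_step n s) z - ip (simple_step N s) z)).
      exact: (integrableB mD (istep n) (istep N)).
    apply: le_trans (ler_norm _) _; apply: le_trans (le_normr_Rintegral mD ie) _.
    apply: (@le_trans _ _ (\int[leb]_(s in D) (e / (L + 1) * `|z|))).
      apply: le_Rintegral => //.
      - exact: integrable_norm.
      - by apply: (@bounded_integrable _ _ _ leb D mD Doo _ `|e / (L + 1) * `|z| |).
      move=> s Ds; rewrite -dotBl (le_trans (cauchy_schwarz H_hilbert _ _))// ler_wpM2r//.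
      rewrite (_ : _ - _ = (F s - simple_step N s) - (F s - simple_step n s)); last first.
        by rewrite opprB [RHS]addrC addrA subrK.
      rewrite (le_trans (ler_normB _ _))//.
      have -> : e / (L + 1) = e / (2 * (L + 1)) + e / (2 * (L + 1)).
        by field; rewrite gt_eqF// ltr_wpDl.
      by rewrite lerD// hN.
    rewrite Rintegral_cst// leb_D/= -/L mulrAC ler_wpM2r//.
    by rewrite mulrAC ler_pdivrMr ?ltr_wpDl// ler_wpM2l ?(ltW e0)// lerDl.
  have [->|z0] := eqVneq z 0; first by rewrite normr0 ltW.
  by move: zz; rewrite expr2 ler_pM2r// normr_gt0.
exists (limn I), simple_step; split => //.
- apply: aeW => s Ds; apply/cvgrPdist_le => e /step_close[N hN].
  by exists N => // n /= Nn; exact: hN.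
- apply/fine_cvgP; split.
    have [N hN] := step_close ltr01; exists N => // n /= Nn.
    rewrite ge0_fin_numE; last by apply: integral_ge0 => s _; rewrite lee_fin.
    apply: (@le_lt_trans _ _ (\int[leb]_(s in D) 1%:E)%E).
      apply: ge0_le_integral => //.
        by apply/measurable_EFinP; exact: measurable_dist.
      by move=> s Ds; rewrite lee_fin; exact: hN.
    by rewrite integral_cst// mul1e.
  apply/cvgrPdist_le => e e0.
  have e1 : 0 < e / (L + 1) by rewrite divr_gt0// ltr_wpDl.
  have [N hN] := step_close e1; exists N => // n /= Nn.
  rewrite sub0r normrN ger0_norm; last first.
    by rewrite fine_ge0//; apply: integral_ge0 => s _; rewrite lee_fin.
  apply: (@le_trans _ _ (\int[leb]_(s in D) (e / (L + 1)))).
    apply: le_Rintegral => //.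
    + apply: (@bounded_integrable _ _ _ leb D mD Doo _ (e / (L + 1))).
        exact: measurable_dist.
      by move=> s Ds; rewrite normr_id; exact: hN.
    + by apply: (@bounded_integrable _ _ _ leb D mD Doo _ `|e / (L + 1)|).
    by move=> s Ds; exact: hN.
  rewrite Rintegral_cst// leb_D/= -/L.
  by rewrite mulrAC ler_pdivrMr ?ltr_wpDl// ler_wpM2l ?(ltW e0)// lerDl.
Qed.

End bochner_continuous.

Section bochner_mild.
Context d (X : measurableType d) (R : realType) (H : completeNormedModType R).
Variables (m : {measure set X -> \bar R}) (D : set X).

Lemma eq_bochner_integral (f g : X -> H) y : (forall x, D x -> f x = g x) ->
  is_bochner_integral m D f y -> is_bochner_integral m D g y.
Proof.
move=> fg [s [sint sae sL1 sy]]; exists s; split => //.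
- by apply: filterS sae => x /= sx Dx; rewrite -fg//; exact: sx.
- rewrite (_ : (fun n => _) = (fun n => \int[m]_(x in D) `|f x - s n x|%:E)%E)//.
  apply/funext => n; apply: eq_integral => x /set_mem Dx.
  by rewrite fg.
Qed.

End bochner_mild.

(** An interval of length less than 1 has L2 norm below the sup norm. *)
Lemma L2_control_bounded (R : realType) (T M : R) (v : R -> R) : 0 < T < 1 ->
  continuous v -> (forall s, `|v s| <= M) ->
  L2_control T v /\ (L2_norm T v <= M%:E)%E.
Proof.
move=> /andP[T0 T1] cv vM; have M0 : 0 <= M by exact: le_trans (vM 0).
have mv : measurable_fun setT (v \_ `]0, T[).
  apply/(measurable_restrictT _ _).1 => //; apply: measurable_funTS.
  exact: continuous_measurable_fun.
have nle : (L2_norm T v <= M%:E)%E.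
  rewrite /L2_norm unlock.
  have -> : M%:E = ((M ^+ 2)%:E `^ 2^-1)%E.
    by rewrite poweR_EFin powR12_sqrt ?sqr_ge0// sqrtr_sqr ger0_norm.
  have -> : (\int[@lebesgue_measure R]_x `|(EFin \o v \_ `]0%R, T[) x| `^ 2 =
      \int[@lebesgue_measure R]_x ((v \_ `]0%R, T[ x) ^+ 2)%:E)%E.
    apply: eq_integral => x _ /=.
    by rewrite (powR_mulrn 2) ?normr_ge0// real_normK ?num_real.
  have ge0I : (0 <= \int[@lebesgue_measure R]_x ((v \_ `]0%R, T[ x) ^+ 2)%:E)%E.
    by apply: integral_ge0 => x _; rewrite lee_fin sqr_ge0.
  apply: gt0_ler_poweR => //.
  - by rewrite in_itv/= ge0I leey.
  - by rewrite in_itv/= lee_fin sqr_ge0 leey.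
  apply: (@le_trans _ _ (\int[@lebesgue_measure R]_(x in `]0%R, T[) (M ^+ 2)%:E)%E).
    rewrite [leRHS]integral_mkcond; apply: ge0_le_integral => //.
    - by move=> *; rewrite lee_fin sqr_ge0.
    - by apply/measurable_EFinP; exact: measurable_funX.
    - by apply/(measurable_restrictT _ _).1.
    move=> x _; rewrite /patch; case: ifP => _; last by rewrite expr0n.
    by rewrite lee_fin -real_normK ?num_real// lerXn2r ?nnegrE.
  rewrite integral_cst//=.
  rewrite [X in (_ * X)%E](_ : _ = T%:E); last first.
    rewrite -[LHS]/(@lebesgue_measure R `]0, T[%classic) (@lebesgue_measure_itv R `]0, T[%R)/=.
    by rewrite lte_fin T0 oppr0 adde0.
  by rewrite -EFinM lee_fin ler_piMr ?sqr_ge0// ltW.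
split => //; apply/andP; split; first by rewrite inE.
by rewrite inE/= /finite_norm (le_lt_trans nle)// ltry.
Qed.

(** * Null controllability *)

Theorem theorem1p3 (R : realType) (a b cW1 cW2 cw : R)
  (ha : 1 / 2 <= a < 5 / 8) (hb : 0 < b < 1 / 2)
  (hcW1 : 0 < cW1) (hcW2 : 0 < cW2) (hcw : 0 < cw)
  (mu : nat -> R) (mu_incr : increasing_seq mu) (mu_ge1 : 1 <= mu 0%N)
  (mu_weyl : forall x : R, mu 0%N <= x ->
    ((cW1 * x `^ a - cW2 * x `^ b)%:E <= counting_fun mu x)%E /\
    (counting_fun mu x <= (cW1 * x `^ a + cW2 * x `^ b)%:E)%E)
  (mu_gap : forall k : nat, expR (- cw * mu k `^ (1 / 2)) <= mu k.+1 - mu k)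
  (H : completeNormedModType R) (ip : {dot H for idfun})
  (H_hilbert : norm_of_dot ip) (H_separable : separable_space H)
  (phi : nat -> H) (phi_basis : hilbert_basis ip phi)
  (B : H) (delta : R) (hdelta : 0 < delta < 1)
  (hB : exists2 CB : R, 0 < CB &
    forall k : nat, expR (- CB * mu k `^ (1 - delta)) <= `|ip B (phi k)|) :
  let eps := 1 / 4 * Num.min (5 - 8 * a) (1 - 2 * b) in
  let alpha := Num.max ((1 - eps) / eps) ((1 - delta) / delta) in
  exists2 C : R, 0 < C &
    forall (xi0 : H) (T : R), 0 < T < 1 ->
    exists2 v : R -> R, L2_control T v &
      (exists xi : R -> H,
        [/\ mild_solution ip phi mu B T v xi0 xi,
            forall xi' : R -> H, mild_solution ip phi mu B T v xi0 xi' ->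
              forall t : R, 0 <= t <= T -> xi' t = xi t
          & xi T = 0]) /\
      (L2_norm T v <= (C * expR (C / T `^ alpha) * `|xi0|)%:E)%E.
Proof.
move=> eps alpha; case: hB => CB CB0 hbeta.
have /andP[a1 a2] := ha; have /andP[b1 b2] := hb; have /andP[d1 d2] := hdelta.
have eps_lo : 0 < eps by rewrite /eps mulr_gt0// lt_min; apply/andP; split; lra.
have eps_a : eps <= 1 / 4 * (5 - 8 * a) by rewrite /eps ler_wpM2l// ge_min lexx.
have eps_b : eps <= 1 / 4 * (1 - 2 * b) by rewrite /eps ler_wpM2l// ge_min lexx orbT.
clearbody eps.
have eps01 : 0 < eps < 1 by apply/andP; split; lra.
have alpha_e : (1 - eps) / eps <= alpha by rewrite /alpha le_max lexx.
have alpha_d : (1 - delta) / delta <= alpha by rewrite /alpha le_max lexx orbT.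
(* From eps <= 1/4, which holds as a >= 1/2. *)
have alpha3 : 3 <= alpha by apply: le_trans alpha_e; rewrite ler_pdivlMr//; lra.
have mu1 k : 1 <= mu k by rewrite (le_trans mu_ge1)// mu_incr.
have mu0 k : 0 <= mu k by exact: le_trans (mu1 k).
have mu_nd : nondecreasing_seq mu by move=> i j ij; rewrite mu_incr.
have K0 : 0 < cW1 + cW2 by rewrite addr_gt0.
have rank k : k.+1%:R <= (cW1 + cW2) * mu k.
  apply: (@le_trans _ _ ((cW1 + cW2) * mu k `^ a)).
    by apply: (@weyl_rank_le R mu mu_incr a b) => //; lra.
  by rewrite (ler_wpM2l (ltW K0))// ler1_powR//; lra.
have [C1 C10 bio] : exists2 C1, 0 < C1 & forall T k, 0 < T < 1 ->
    exists q : R -> R, [/\ continuous q, (forall s, q s != 0 -> 0 <= s <= T),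
    (forall s, `|q s| <= C1 * expR (C1 / T ^+ 3 + C1 * mu k `^ (1 - eps) - mu k * (T / 2))) &
    forall j, exp_moment T (mu j) q = (j == k)%:R].
  (* With theta = 1 - eps, the second condition reads 1 - eps >= 3/4 + b/2 >= 1/2 + b, by b <
     1/2. *)
  apply: (@biorthogonal_family_weyl R mu a b cW1 cW2 cw) => //; lra.
have [C C0 hC] := moment_control eps01 hdelta alpha3 alpha_e alpha_d mu1 K0 rank CB0 hbeta C10 bio.
exists C => // xi0 T T01; have /andP[T0 T1] := T01.
have [phi_on _] := phi_basis.
have phi1 k : `|phi k| = 1 by exact: orthonormal_norm.
have xk k : `|ip xi0 (phi k)| <= `|xi0|.
  by rewrite (le_trans (cauchy_schwarz H_hilbert _ _))// phi1 mulr1.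
have [v [cv v0 vb vm]] := hC _ _ _ xk T01.
have [vL vN] := L2_control_bounded T01 cv vb.
exists v => //; split => //.
pose S := diag_semigroup ip phi mu.
pose F t s := v s *: S (Num.max (t - s) 0) B.
have cF t : continuous (F t) by exact: continuous_semigroup_arg.
have FE t s : `]0, t[%classic s -> F t s = v s *: S (t - s) B.
  by rewrite /= in_itv/= /F => /andP[_ st]; rewrite max_l// subr_ge0 ltW.
have /choice[y yP] t := bochner_integral_exists H_hilbert t (@cF t).
have y_phi t z k : is_bochner_integral (@lebesgue_measure R) `]0, t[ (F t) z ->
    ip z (phi k) = \int[@lebesgue_measure R]_(s in `]0, t[) ip (F t s) (phi k).
  by apply: dot_bochner_integral => //; rewrite phi1.
exists (fun t => S t xi0 - y t); split.
- move=> t /andP[t0 tT]; exists (y t) => //.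
  by apply: eq_bochner_integral (yP t) => s; exact: FE.
(* Uniqueness amounts to that of the Bochner integral, whose coefficients on the basis are scalar
   integrals of the integrand. *)
- move=> xi' hxi' t tT; have [z zP ->] := hxi' t tT; congr (_ - _).
  apply: (dot_basis_inj H_hilbert phi_basis) => k.
  transitivity (\int[@lebesgue_measure R]_(s in `]0, t[) ip (F t s) (phi k)).
    by apply: y_phi; apply: eq_bochner_integral zP => s /FE ->.
  by apply/esym/y_phi; exact: yP.
- apply/eqP; rewrite subr_eq0; apply/eqP/(dot_basis_inj H_hilbert phi_basis) => k.
  rewrite (y_phi T (y T) k (yP T)) dot_semigroup//; last exact: ltW.
  have beta0 : ip B (phi k) != 0.
    by rewrite -normr_gt0 (lt_le_trans _ (hbeta k))// expR_gt0.
  have cve : continuous (fun s => v s * expR (mu k * s)) by exact: continuous_mul_expR.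
  have ive := @continuous_integrable_itv R _ 0 T cve.
  (* Factor e^(- mu_k (T - s)) as e^(- mu_k T) e^(mu_k s): the remaining integral is the prescribed
     moment xi0_k / B_k. *)
  transitivity (\int[@lebesgue_measure R]_(s in `]0, T[)
      (ip B (phi k) * expR (- mu k * T) * (v s * expR (mu k * s)))); last first.
    apply: eq_Rintegral => s /set_mem sT; rewrite FE// dotZl dot_semigroup//.
      rewrite (_ : - mu k * (T - s) = - mu k * T + mu k * s); last by ring.
      by rewrite expRD; ring.
    by move: sT; rewrite /= in_itv/= subr_ge0 => /andP[_ /ltW].
  have ive' : (@lebesgue_measure R).-integrable `]0, T[ (EFin \o (fun s => v s * expR (mu k * s))).
    apply: (integrableS _ _ _ ive) => //.
    by move=> x /=; rewrite !in_itv/= => /andP[/ltW-> /ltW->].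
  rewrite RintegralZl// (_ : \int[_]_(_ in _) _ = exp_moment T (mu k) v).
    by rewrite vm mulrAC mulrC; field.
  (* The moment is taken on the closed interval, the mild solution on the open one; the endpoints
     are negligible. *)
  rewrite /exp_moment Rintegral_itv_bndo_bndc// Rintegral_itv_obnd_cbnd//.
  apply: (integrableS _ _ _ ive) => //.
  by move=> x /=; rewrite !in_itv/= => /andP[/ltW-> ->].
Qed.
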